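(* Let $X$ be a random vector and let $P$ be a $\sigma(X)$-measurable random variable. Then: (i) $P$ is a p-variable if and only if there exists a $\sigma(X)$-measurable random variable $T$ such that $P\ge \mathbb P(T'\le T\mid X)$, where $T'$ is a copy of $T$ independent of $X$; (ii) $P$ is a p*-variable if and only if there exists a random variable $T$ such that $P\ge\mathbb P(T'\le T\mid X)$, where $T'$ is a copy of $T$ independent of $(T,X)$. Moreover, statement (ii) remains true if $\mathbb P(T'\le T\mid X)$ is replaced by $\tfrac12\mathbb P(T'\le T\mid X)+\tfrac12\mathbb P(T'<T\mid X)$.
   Context: All random variables live on a fixed atomless probability space $(\Omega,\mathcal A,\mathbb P)$, assumed rich enough that for any given random vector there exists a random variable uniform on $[0,1]$ independent of it. A copy of $T$ is a random variable identically distributed as $T$. For random variables $X,Y$: $X\le_1 Y$ means $\mathbb E[f(X)]\le \mathbb E[f(Y)]$ for all increasing real functions $f$ such that the expectations exist; $X\le_2 Y$ means the same inequality for all increasing concave real functions $f$ such that the expectations exist (''increasing'' is non-strict). With $U$ uniform on $[0,1]$: $P$ is a p-variable if $U\le_1 P$ (equivalently $\mathbb P(P\le\alpha)\le\alpha$ for all $\alpha\in(0,1)$); $P$ is a p*-variable if $U\le_2 P$. Conditional probabilities and inequalities involving them are understood almost surely. *)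

(* Defs.v *)
From HB Require Import structures.
From mathcomp Require Import all_boot all_order all_algebra.
From mathcomp Require Import all_classical all_reals all_analysis.

Set Implicit Arguments.
Unset Strict Implicit.
Unset Printing Implicit Defensive.

Import Order.TTheory GRing.Theory Num.Theory.
Import numFieldNormedType.Exports.

Local Open Scope classical_set_scope.
Local Open Scope ring_scope.
Local Open Scope ereal_scope.

Section definitions.
Context {d : measure_display} {Omega : measurableType d} {R : realType}.
Variable Pr : probability Omega R.

Definition atomless : Prop := forall A : set Omega,
  measurable A -> 0 < Pr A ->
  exists B : set Omega, [/\ measurable B, B `<=` A, 0 < Pr B & Pr B < Pr A].

Definition identically_distributed {d'} {S : measurableType d'}
    (X Y : {RV Pr >-> S}) : Prop :=
  forall A : set S, measurable A -> distribution Pr X A = distribution Pr Y A.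

Definition independent {d1 d2} {S1 : measurableType d1}
    {S2 : measurableType d2} (X : Omega -> S1) (Y : Omega -> S2) : Prop :=
  forall (A : set S1) (B : set S2), measurable A -> measurable B ->
    Pr ((X @^-1` A) `&` (Y @^-1` B)) = Pr (X @^-1` A) * Pr (Y @^-1` B).

Definition uniform01 (U : {RV Pr >-> R}) : Prop := forall A : set R,
  measurable A -> distribution Pr U A = uniform_prob (@ltr01 R) A.

Definition rich : Prop := forall (m : nat) (Y : {RV Pr >-> m.-tuple R}),
  exists U : {RV Pr >-> R}, uniform01 U /\ independent U Y.

Definition sigma_measurable {d'} {S : measurableType d'}
    (X : Omega -> S) (Z : Omega -> R) : Prop :=
  measurable_fun [set: g_sigma_algebra_preimageType X] Z.

(* [Q] is a version of the conditional probability of the event [A] given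
   [X]; versions exist and any two of them agree almost surely. *)
Definition is_cond_prob {d'} {S : measurableType d'}
    (X : Omega -> S) (A : set Omega) (Q : Omega -> R) : Prop :=
  [/\ sigma_measurable X Q,
      Pr.-integrable [set: Omega] (EFin \o Q) &
      forall B : set Omega, g_sigma_algebra_preimage X B ->
        \int[Pr]_(w in B) (Q w)%:E = Pr (A `&` B)].

(* Existence is meant in [-oo, +oo].  Requiring a finite expectation instead
   would leave only the constant test functions in [le2 U P] whenever the
   negative part of [P] is not integrable. *)
Definition expectation_exists (Z : Omega -> R) : Prop :=
  'E_Pr[(Z^\+)%R] < +oo \/ 'E_Pr[(Z^\-)%R] < +oo.

Definition le1 (X Y : {RV Pr >-> R}) : Prop := forall f : R -> R,
  {homo f : x y / (x <= y)%R} ->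
  expectation_exists (f \o X) -> expectation_exists (f \o Y) ->
  'E_Pr[f \o X] <= 'E_Pr[f \o Y].

Definition concave_function (f : R -> R) : Prop :=
  convex_function [set: R^o] (fun x : R^o => (- f x)%R).

Definition le2 (X Y : {RV Pr >-> R}) : Prop := forall f : R -> R,
  {homo f : x y / (x <= y)%R} -> concave_function f ->
  expectation_exists (f \o X) -> expectation_exists (f \o Y) ->
  'E_Pr[f \o X] <= 'E_Pr[f \o Y].

(* [le1 U P] and [le2 U P] depend on [U] through its law only, so the choice
   of the uniform variable is immaterial. *)
Definition p_variable (P : {RV Pr >-> R}) : Prop :=
  exists U : {RV Pr >-> R}, uniform01 U /\ le1 U P.

Definition pstar_variable (P : {RV Pr >-> R}) : Prop :=
  exists U : {RV Pr >-> R}, uniform01 U /\ le2 U P.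

End definitions.

(* Main.v *)
(** A p*-variable [P] satisfies E(c - P)^+ <= c^2/2 for 0 <= c <= 1, the right-hand
    side being the value for a uniform variable (its stop-loss transform).  After
    truncating [P] to [V0] with mean 1/2, a uniform variable [V] with
    E[V | X] = V0 is built in the manner of Chacon and Walsh: if
    [l_t] is the tangent to c^2/2 at [t], and [l_t] exceeds the stop-loss transform
    of the current variable exactly on (a, b), then splitting the mass of (a, b)
    between [a] and [b] by an independent randomization preserves conditional means
    and replaces the transform by its maximum with [l_t].  Treating the
    midpoints of the dyadic cells level by level, mass never leaves its cell, so
    the variables converge uniformly, and the transform of the limit is c^2/2 at
    all dyadic points.  Taking T = V and T' an independent uniform variable,
    P(T' <= T | X) = E[V | X] = V0 <= P.

    Conversely, if [F] is the distribution function of [T], then P(T' <= T | X) is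
    E[F(T) | X], which dominates E[W | X] where W = F(T-) + U (F(T) - F(T-)), with [U]
    uniform and independent of (T, X), is the distributional transform of [T] and is
    uniform; conditional Jensen concludes.  For part (i), [T] is a function of [X], so
    that W <= F(T) <= P; in the other direction one takes T = P, whose distribution
    function is at most the identity on (0, 1). *)
Require Import Defs.
From HB Require Import structures.
From mathcomp Require Import all_boot all_order all_algebra.
From mathcomp Require Import all_classical all_reals all_analysis.
From mathcomp Require Import measurable_realfun zify ring lra.

Set Implicit Arguments.
Unset Strict Implicit.
Unset Printing Implicit Defensive.

Import Order.TTheory GRing.Theory Num.Theory.
Import numFieldNormedType.Exports.

Local Open Scope classical_set_scope.
Local Open Scope ring_scope.

(** * Means of bounded measurable variables *)

Section bounded_variables.
Context {d : measure_display} {Omega : measurableType d} {R : realType}.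
Variable Pr : probability Omega R.
Implicit Types (Y Z : Omega -> R) (A B : set Omega).

Definition bounded_measurable Z :=
  measurable_fun setT Z /\ exists M, forall w, `|Z w| <= M.

Local Notation E := (Rintegral Pr setT).

Lemma itv_bounded_measurable Z a b : measurable_fun setT Z ->
  (forall w, a <= Z w <= b) -> bounded_measurable Z.
Proof.
move=> mZ Zab; split=> //; exists (Num.max `|a| `|b|) => w.
have /andP[aZ Zb] := Zab w; rewrite ler_norml; apply/andP; split.
  by rewrite (le_trans _ aZ)// lerNl le_max -normrN ler_norm.
by rewrite (le_trans Zb)// le_max ler_norm orbT.
Qed.

Lemma bounded_measurable_integrable Z D : measurable D ->
  bounded_measurable Z -> Pr.-integrable D (EFin \o Z).
Proof.
move=> mD [mZ [M ZM]]; apply: (@integrableS _ _ _ _ setT) => //.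
apply: measurable_bounded_integrable => //.
  by rewrite (le_lt_trans (probability_le1 _ _))// ltry.
exists M; split; first exact: num_real.
by move=> x Mx w _; exact: le_trans (ZM w) (ltW Mx).
Qed.

Lemma bounded_measurableD Y Z : bounded_measurable Y -> bounded_measurable Z ->
  bounded_measurable (fun w => Y w + Z w).
Proof.
move=> [mY [M YM]] [mZ [N ZN]]; split; first exact: measurable_funD.
by exists (M + N) => w; rewrite (le_trans (ler_normD _ _))// lerD.
Qed.

Lemma bounded_measurableM Y Z : bounded_measurable Y -> bounded_measurable Z ->
  bounded_measurable (fun w => Y w * Z w).
Proof.
move=> [mY [M YM]] [mZ [N ZN]]; split; first exact: measurable_funM.
by exists (M * N) => w; rewrite normrM ler_pM.
Qed.

Lemma bounded_measurable_cst c : bounded_measurable (fun=> c).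
Proof. by split=> //; exists `|c|. Qed.

Lemma bounded_measurableZ c Z : bounded_measurable Z ->
  bounded_measurable (fun w => c * Z w).
Proof. exact/bounded_measurableM/bounded_measurable_cst. Qed.

Lemma bounded_measurableB Y Z : bounded_measurable Y -> bounded_measurable Z ->
  bounded_measurable (fun w => Y w - Z w).
Proof.
move=> bY /(bounded_measurableZ (-1)) bZ.
rewrite (_ : (fun w => _) = (fun w => Y w + (-1 * Z w))); first exact: bounded_measurableD.
by apply/funext => w; rewrite mulN1r.
Qed.

Lemma bounded_measurable_indic A : measurable A -> bounded_measurable \1_A.
Proof.
move=> mA; apply: (@itv_bounded_measurable _ 0 1) => [|w]; first exact: measurable_indic.
by rewrite indicE; case: (_ \in _); rewrite /= ?lexx ler01.
Qed.

Lemma meanD Y Z : bounded_measurable Y -> bounded_measurable Z ->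
  E (fun w => Y w + Z w) = E Y + E Z.
Proof. by move=> bY bZ; rewrite RintegralD//; exact: bounded_measurable_integrable. Qed.

Lemma meanB Y Z : bounded_measurable Y -> bounded_measurable Z ->
  E (fun w => Y w - Z w) = E Y - E Z.
Proof. by move=> bY bZ; rewrite RintegralB//; exact: bounded_measurable_integrable. Qed.

Lemma meanZ c Z : bounded_measurable Z -> E (fun w => c * Z w) = c * E Z.
Proof. by move=> bZ; rewrite RintegralZl//; exact: bounded_measurable_integrable. Qed.

Lemma mean_cst c : E (fun=> c) = c.
Proof. by rewrite Rintegral_cst//= (probability_setT Pr)/= mulr1. Qed.

Lemma le_mean Y Z : bounded_measurable Y -> bounded_measurable Z ->
  (forall w, Y w <= Z w) -> E Y <= E Z.
Proof. by move=> bY bZ YZ; apply: le_Rintegral => //; exact: bounded_measurable_integrable. Qed.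

Lemma mean_indic A : measurable A -> E \1_A = fine (Pr A).
Proof. by move=> mA; rewrite /Rintegral integral_indic// setIT. Qed.

Lemma mean_fineK Z : bounded_measurable Z -> (E Z)%:E = (\int[Pr]_w (Z w)%:E)%E.
Proof.
by move=> bZ; rewrite /Rintegral fineK//;
  exact/integrable_fin_num/bounded_measurable_integrable.
Qed.

Lemma mean_restrict Z B :
  \int[Pr]_(w in B) Z w = E (fun w => Z w * \1_B w).
Proof.
rewrite Rintegral_mkcond; apply: eq_Rintegral => w _.
by rewrite patchE indicE; case: ifPn => _; rewrite ?mulr1 ?mulr0.
Qed.

Lemma mean_le_dist Y Z e : bounded_measurable Y -> bounded_measurable Z ->
  (forall w, `|Y w - Z w| <= e) -> `|E Y - E Z| <= e.
Proof.
move=> bY bZ YZ; rewrite -meanB// ler_norml.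
have bYZ := bounded_measurableB bY bZ.
have YZe w : - e <= Y w - Z w <= e by rewrite -ler_norml.
apply/andP; split.
  rewrite -[leLHS]mean_cst; apply: le_mean => //; first exact: bounded_measurable_cst.
  by move=> w; have /andP[] := YZe w.
rewrite -[leRHS]mean_cst; apply: le_mean => //; first exact: bounded_measurable_cst.
by move=> w; have /andP[] := YZe w.
Qed.

End bounded_variables.

Definition as_mfun {d1 d2} {S1 : measurableType d1} {S2 : measurableType d2}
    (f : S1 -> S2) (mf : measurable_fun setT f) : {mfun S1 >-> S2} :=
  MeasurableFun.Pack (MeasurableFun.Class (isMeasurableFun.Build _ _ _ _ _ mf)).

(** * Fubini's theorem for independent variables *)

Section independence.
Context {d : measure_display} {Omega : measurableType d} {R : realType}.
Variable Pr : probability Omega R.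
Local Notation E := (Rintegral Pr setT).

(** Independence makes the joint law of [(V, Y)] agree with the product of the marginal laws on
    rectangles, hence everywhere, and Tonelli's theorem applies. The bound [M] keeps the inner
    integrals finite, so that passing through [fine] loses nothing. *)
Lemma independent_fubini {d1 d2} {S1 : measurableType d1} {S2 : measurableType d2}
    (V : Omega -> S1) (Y : Omega -> S2) (g : S1 * S2 -> R) M :
  measurable_fun setT V -> measurable_fun setT Y -> independent Pr V Y ->
  measurable_fun setT g -> (forall z, 0 <= g z <= M) ->
  E (fun w => g (V w, Y w)) = E (fun w => E (fun w' => g (V w', Y w))).
Proof.
move=> mV mY VY mg g0M.
pose VY' := as_mfun (measurable_fun_pair mV mY).
pose V' := as_mfun mV; pose Y' := as_mfun mY.
pose G := EFin \o g.
have mG : measurable_fun setT G by exact/measurable_EFinP.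
have G0 z : (0 <= G z)%E by rewrite lee_fin; have /andP[] := g0M z.
have -> : E (fun w => g (V w, Y w)) = fine (\int[distribution Pr VY']_z G z)%E.
  by rewrite ge0_integral_distribution.
have -> : (\int[distribution Pr VY']_z G z)%E =
    (\int[(distribution Pr V' \x distribution Pr Y')%E]_z G z)%E.
  apply: eq_measure_integral => A mA _.
  exact/esym/product_measure_unique.
rewrite fubini_tonelli1// fubini_tonelli//.
have mH : measurable_fun setT (fubini_G (distribution Pr V') G).
  exact: measurable_fun_fubini_tonelli_G.
rewrite ge0_integral_distribution//; last first.
  by move=> y; apply: integral_ge0 => ? _.
rewrite /Rintegral; congr fine; apply: eq_integral => w _ /=.
rewrite /fubini_G ge0_integral_distribution//; last first.
  by apply: measurableT_comp => //; exact: measurable_pair2.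
have bg : bounded_measurable (fun w' => g (V w', Y w)).
  apply: (@itv_bounded_measurable _ _ _ _ 0 M) => [|//].
  by apply: measurableT_comp => //; exact: measurable_fun_pair.
by rewrite [RHS](mean_fineK Pr bg).
Qed.

End independence.

(** * Distribution functions and uniform variables *)

Section real_probability.
Context {d : measure_display} {Omega : measurableType d} {R : realType}.
Variable Pr : probability Omega R.
Implicit Types (A B : set Omega) (T : Omega -> R).

Local Notation "'P[' A ]" := (fine (Pr A)) (format "'P[' A ]").

Lemma prob_fineK A : measurable A -> (P[A])%:E = Pr A.
Proof. by move=> mA; rewrite fineK// fin_num_measure. Qed.

Lemma prob_ge0 A : 0 <= P[A].
Proof. by rewrite fine_ge0. Qed.

Lemma le_prob A B : measurable A -> measurable B -> A `<=` B -> P[A] <= P[B].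
Proof.
move=> mA mB AB; rewrite fine_le ?fin_num_measure//.
by rewrite le_measure ?inE.
Qed.

Lemma prob_setT : P[setT] = 1.
Proof. by rewrite (probability_setT Pr). Qed.

Lemma prob_le1 A : measurable A -> P[A] <= 1.
Proof. by move=> mA; rewrite -prob_setT; apply: le_prob. Qed.

Lemma prob_setU A B : measurable A -> measurable B -> [disjoint A & B] ->
  P[A `|` B] = P[A] + P[B].
Proof.
move=> mA mB /disj_set2P AB0.
by rewrite measureU// fineD// fin_num_measure.
Qed.

Lemma prob_setC A : measurable A -> P[~` A] = 1 - P[A].
Proof. by move=> mA; rewrite (probability_setC Pr)// -prob_fineK. Qed.

Lemma measurable_le_cst T c : measurable_fun setT T -> measurable [set w | T w <= c].
Proof.
by move=> mT; have := mT measurableT _ (measurable_itv `]-oo, c]); rewrite setTI.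
Qed.

Lemma measurable_lt_cst T c : measurable_fun setT T -> measurable [set w | T w < c].
Proof.
by move=> mT; have := mT measurableT _ (measurable_itv `]-oo, c[); rewrite setTI.
Qed.

(** The suffixes stand for right- and left-continuous: [cdfr T] is the distribution function and
    [cdfl T] gives its left limits. *)
Definition cdfr T t := P[[set w | T w <= t]].
Definition cdfl T t := P[[set w | T w < t]].

Section cdf_theory.
Variable T : Omega -> R.
Hypothesis mT : measurable_fun setT T.
Let F := cdfr T.
Let G := cdfl T.

Lemma cdfr_homo : {homo F : s t / s <= t}.
Proof.
move=> s t st; apply: le_prob; try exact: measurable_le_cst.
by move=> w /= /le_trans; apply.
Qed.

Lemma cdfl_homo : {homo G : s t / s <= t}.
Proof.
move=> s t st; apply: le_prob; try exact: measurable_lt_cst.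
by move=> w /= /lt_le_trans; apply.
Qed.

Lemma cdfl_le_cdfr t : G t <= F t.
Proof.
apply: le_prob; [exact: measurable_lt_cst|exact: measurable_le_cst|].
by move=> w /= /ltW.
Qed.

Lemma cdfr_le_cdfl s t : s < t -> F s <= G t.
Proof.
move=> st; apply: le_prob; [exact: measurable_le_cst|exact: measurable_lt_cst|].
by move=> w /= /le_lt_trans; apply.
Qed.

Lemma cdfr_itv t : 0 <= F t <= 1.
Proof. by rewrite prob_ge0 prob_le1//; exact: measurable_le_cst. Qed.

Lemma cdfl_itv t : 0 <= G t <= 1.
Proof. by rewrite prob_ge0 prob_le1//; exact: measurable_lt_cst. Qed.

Lemma cdfr_atom t : F t = G t + P[[set w | T w = t]].
Proof.
rewrite -prob_setU; last 3 first.
- exact: measurable_lt_cst.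
- by have := mT measurableT (measurable_set1 t); rewrite setTI.
- by apply/disj_set2P; rewrite predeqE => w; split=> //= -[/[swap] ->]; rewrite ltxx.
congr (fine (Pr _)); rewrite predeqE => w /=; rewrite le_eqVlt; split.
  by move=> /predU1P[|]; [right|left].
by move=> [->|->]; rewrite ?orbT ?eqxx.
Qed.

Let X : {RV Pr >-> R} := as_mfun mT.
Let cdfE : fine \o cdf X = F.
Proof. by []. Qed.

Let cdfK t : cdf X t = (F t)%:E.
Proof. by rewrite prob_fineK//; exact: measurable_le_cst. Qed.

Definition quantile (u : R) := inf [set x | u <= F x].

Lemma cdfr_lt_ex (u : R) : 0 < u -> exists x, F x < u.
Proof.
move=> u0; have := @cvg_cdfNy0 _ _ _ _ X.
rewrite -[0%E]/(0%:E) => /fine_cvg/cvgr_lt/(_ _ u0)/filter_ex[x xu].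
by exists x.
Qed.

Lemma cdfr_gt_ex (u : R) : u < 1 -> exists x, u < F x.
Proof.
move=> u1; have := @cvg_cdfy1 _ _ _ _ X.
rewrite -[1%E]/(1%:E) => /fine_cvg/cvgr_gt/(_ _ u1)/filter_ex[x xu].
by exists x.
Qed.

(** This Galois connection rests on right continuity: if [F x < u], then still [F t < u] for some
    [t > x], whereas [quantile u <= x < t] would provide a point below [t] where [F] has reached
    [u]. *)
Lemma quantile_le (u x : R) : 0 < u < 1 -> (quantile u <= x) = (u <= F x).
Proof.
move=> /andP[u0 u1].
have [z Fz] := cdfr_lt_ex u0; have [y Fy] := cdfr_gt_ex u1.
have lbz : lbound [set x | u <= F x] z.
  by move=> t /= ut; rewrite leNgt; apply/negP => /ltW/cdfr_homo; lra.
apply/idP/idP => [qx|ux]; last by apply: ge_inf => //; exists z.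
rewrite leNgt; apply/negP => Fxu.
have : (fine \o cdf X) x @[x --> x^'+] --> F x.
  by apply: fine_cvg; rewrite -cdfK; exact: cdf_right_continuous.
move=> /cvgr_lt/(_ _ Fxu) FF.
have [t [/= Ftu xt]] : exists t, F t < u /\ x < t.
  near x^'+ => t; exists t; split; near: t; [exact: FF|exact: nbhs_right_gt].
have [s /= us st] := inf_lt (ex_intro _ y (ltW Fy)) (le_lt_trans qx xt).
by have := cdfr_homo (ltW st); lra.
Unshelve. all: by end_near. Qed.

(** The event [T < t] is the increasing union of the events [T <= t - 1/(n+1)], each of probability
    at most [u] because its threshold lies strictly below the quantile. *)
Lemma cdfl_quantile (u : R) : 0 < u < 1 -> G (quantile u) <= u.
Proof.
move=> u01; set t := quantile u.
have tE : [set w | T w < t] = \bigcup_n [set w | T w <= t - n.+1%:R^-1].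
  rewrite predeqE => w; split=> [/= /ltr_add_invr[k Tk]|[k _ /= Tk]].
    by exists k => //=; rewrite lerBrDr ltW.
  by rewrite (le_lt_trans Tk)// ltrBlDr ltrDl invr_gt0.
have cv : Pr [set w | T w <= t - n.+1%:R^-1] @[n --> \oo] --> Pr [set w | T w < t].
  rewrite tE; apply: nondecreasing_cvg_mu => [n||m n mn].
  - exact: measurable_le_cst.
  - by rewrite -tE; exact: measurable_lt_cst.
  - apply/subsetPset => w /= /le_trans; apply.
    by rewrite lerD2l lerN2 lef_pV2 ?posrE// ler_nat.
rewrite -lee_fin prob_fineK; last exact: measurable_lt_cst.
rewrite -(cvg_lim _ cv)//; apply: lime_le; first by apply/cvg_ex; eexists; exact: cv.
apply: nearW => n; rewrite -prob_fineK; last exact: measurable_le_cst.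
rewrite lee_fin -/(F _) leNgt; apply/negP => /ltW.
by rewrite -quantile_le// -/t lerDl oppr_ge0 leNgt invr_gt0 ltr0n.
Qed.

End cdf_theory.

(** The rays []x, +oo[] form a pi-system generating the Borel sets, and agreement on []-oo, x]]
    passes to them by complement. *)
Lemma law_ext (m1 m2 : probability R R) :
  (forall x, m1 `]-oo, x]%classic = m2 `]-oo, x]%classic) ->
  forall A : set R, measurable A -> m1 A = m2 A.
Proof.
move=> m12; apply: (measure_unique (@RGenOInfty.G R) (fun k : nat => `]- k%:R, +oo[%classic)).
- exact: RGenOInfty.measurableE.
- move=> A B [x ->] [y ->]; exists (Num.max x y).
  by rewrite predeqE => z; rewrite /= !in_itv/= !andbT gt_max; split=> [[-> ->]|/andP[]].
- by move=> k; exists (- k%:R).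
- rewrite predeqE => x; split=> // _; exists (Num.trunc (- x)).+1 => //=.
  by rewrite in_itv/= andbT ltrNl truncnS_gt.
- move=> _ [x ->]; rewrite -setCitvl.
  have mx := measurable_itv `]-oo, x].
  by apply: etrans (probability_setC m1 mx) _; rewrite m12 -(probability_setC m2 mx).
- by move=> k; rewrite (le_lt_trans (probability_le1 _ _))// ltry.
Qed.

Lemma uniform_prob_itv c : 0 <= c <= 1 ->
  uniform_prob (@ltr01 R) `]-oo, c]%classic = c%:E.
Proof.
move=> /andP[c0 c1]; rewrite /uniform_prob integral_uniform_pdf.
have -> : (`]-oo, c] `&` `[0, 1])%classic = `[0, c]%classic.
  rewrite predeqE => x /=; rewrite !in_itv/=; split=> [[xc /andP[->]]//|/andP[x0 xc]].
  by split=> //; rewrite x0 (le_trans xc).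
rewrite (eq_integral (fun=> 1%E)); last first.
  move=> x; rewrite inE/= in_itv/= /uniform_pdf => /andP[-> xc].
  by rewrite (le_trans xc)//= subr0 invr1.
rewrite integral_cst//= mul1e lebesgue_measure_itv/= lte_fin.
by have [c0'|c0'] := ltP 0 c; rewrite ?oppr0 ?adde0//; congr EFin; lra.
Qed.

(** The sandwich is what quantile and slope arguments deliver. It forces equality because
    [P(V <= c) <= P(V < c + e) <= c + e] for all small [e > 0]. *)
Lemma uniform01P (V : Omega -> R) (mV : measurable_fun setT V) : (forall w, 0 <= V w <= 1) ->
  (forall c, 0 < c < 1 -> P[[set w | V w < c]] <= c <= P[[set w | V w <= c]]) ->
  uniform01 (as_mfun mV : {RV Pr >-> R}).
Proof.
move=> V01 Vc A mA.
have VE c : 0 < c < 1 -> P[[set w | V w <= c]] = c.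
  move=> c01; apply/eqP; rewrite eq_le; have /andP[_ ->] := Vc _ c01; rewrite andbT.
  apply/ler_addgt0Pr => e e0; have [c1|c1] := ltP (c + e) 1; last first.
    by rewrite (le_trans _ c1)// prob_le1//; exact: measurable_le_cst.
  have /Vc/andP[+ _] : 0 < c + e < 1 by lra.
  apply: le_trans; apply: le_prob; [exact: measurable_le_cst|exact: measurable_lt_cst|].
  by move=> w /= Vw; lra.
have mid : measurable_fun setT (id : measurableTypeR R -> R) by exact: measurable_id.
apply: (@law_ext (distribution Pr (as_mfun mV))
  (distribution (uniform_prob (@ltr01 R)) (as_mfun mid))) => // c.
rewrite -[RHS]/(uniform_prob ltr01 `]-oo, c]%classic).
have {}VE : 0 <= c <= 1 -> P[[set w | V w <= c]] = c.
  move=> c01; have [/eqP ->|c0] := boolP (c == 0).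
    apply/eqP; rewrite eq_le prob_ge0 andbT; apply/ler_addgt0Pr => e e0.
    have [e1|e1] := ltP e 1; last first.
      by rewrite (le_trans (prob_le1 _))//; [exact: measurable_le_cst|lra].
    rewrite add0r -(VE e) ?e0//; apply: le_prob; try exact: measurable_le_cst.
    by move=> w /=; lra.
  have [/eqP ->|c1] := boolP (c == 1); last by apply: VE; lra.
  rewrite -[RHS]prob_setT; congr (fine (Pr _)); rewrite predeqE => w; split=> // _.
  by have /andP[] := V01 w.
rewrite -[LHS]/(Pr [set w | V w <= c]) -prob_fineK; last exact: measurable_le_cst.
have [c0|c0] := ltP c 0.
  have -> : [set w | V w <= c] = set0.
    by rewrite predeqE => w; split=> //=; have := V01 w; lra.
  rewrite measure0/=; apply/esym/eqP; rewrite eq_le measure_ge0 andbT.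
  rewrite -[leRHS](@uniform_prob_itv 0) ?lexx ?ler01//.
  by rewrite le_measure ?inE//; apply: subset_itvl; rewrite bnd_simp ltW.
have [c1|c1] := ltP 1 c; last by rewrite uniform_prob_itv ?c0// VE// c0.
have -> : [set w | V w <= c] = setT.
  by rewrite predeqE => w; split=> //= _; have := V01 w; lra.
rewrite prob_setT; apply/esym/eqP; rewrite eq_le probability_le1//=.
rewrite -[leLHS](@uniform_prob_itv 1) ?lexx ?ler01//.
by rewrite le_measure ?inE//; apply: subset_itvl; rewrite bnd_simp ltW.
Qed.

Lemma uniform01_cdfr (U : {RV Pr >-> R}) c : uniform01 U -> 0 <= c <= 1 -> cdfr U c = c.
Proof.
move=> uU c01; have := uU _ (measurable_itv `]-oo, c]).
rewrite (uniform_prob_itv c01) /cdfr /distribution/pushforward/=.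
by move=> h; rewrite [X in fine X](_ : _ = c%:E).
Qed.

End real_probability.

(** * Randomizers, quantile copies and the distributional transform *)

Section uniform_randomization.
Context {d : measure_display} {Omega : measurableType d} {R : realType}.
Variable Pr : probability Omega R.
Implicit Types (T V : Omega -> R).

Local Notation "'P[' A ]" := (fine (Pr A)) (format "'P[' A ]").
Local Notation F := (cdfr Pr).
Local Notation G := (cdfl Pr).

(** Values lie in the open interval everywhere, not just almost surely, so that quantiles can be
    evaluated at every sample point. *)
Definition randomizer V := [/\ measurable_fun setT V, forall w, 0 < V w < 1 &
  forall c, 0 <= c <= 1 -> F V c = c].

Lemma randomizer_uniform01 V (mV : measurable_fun setT V) : randomizer V ->
  uniform01 (as_mfun mV : {RV Pr >-> R}).
Proof.
move=> [_ V01 FV]; apply: uniform01P => [w|c c01]; first by have := V01 w; lra.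
by rewrite -[X in _ <= X <= _]FV ?cdfl_le_cdfr ?lexx//; lra.
Qed.

Lemma independent_comp {d1 d2 d3 d4} {S1 : measurableType d1} {S2 : measurableType d2}
  {S3 : measurableType d3} {S4 : measurableType d4} (X : Omega -> S1) (Y : Omega -> S2)
  (f : S1 -> S3) (g : S2 -> S4) :
  measurable_fun setT f -> measurable_fun setT g ->
  independent Pr X Y -> independent Pr (f \o X) (g \o Y).
Proof.
move=> mf mg XY A B mA mB; 
have mfA : measurable (f @^-1` A) by rewrite -[X in measurable X]setTI; exact: mf.
have mgB : measurable (g @^-1` B) by rewrite -[X in measurable X]setTI; exact: mg.
exact: (XY _ _ mfA mgB).
Qed.

(** The default 1/2 is an arbitrary point of ]0, 1[, assigned where a uniform variable falls with
    probability 0. *)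
Definition unit_clip (u : R) : R := if 0 < u < 1 then u else 2^-1.

Lemma measurable_unit_clip : measurable_fun setT unit_clip.
Proof.
apply: measurable_fun_ifT => //.
by apply: measurable_and; apply: measurable_fun_ltr.
Qed.

Lemma unit_clip_itv u : 0 < unit_clip u < 1.
Proof. by rewrite /unit_clip; case: ifPn => // _; apply/andP; split; lra. Qed.

Lemma uniform01_randomizer (U : {RV Pr >-> R}) : uniform01 U ->
  randomizer (unit_clip \o U) /\ {ae Pr, forall w, unit_clip (U w) = U w}.
Proof.
move=> uU; have mU : measurable_fun setT U by [].
pose C := U @^-1` `]0, 1[%classic.
have mC : measurable C by rewrite -[X in measurable X]setTI; exact: mU.
have PC : Pr C = 1%E.
  have := uU _ (measurable_itv `]0, 1[).
  rewrite /distribution/pushforward/= => ->.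
  rewrite /uniform_prob (eq_integral (fun=> 1%E)); last first.
    move=> x; rewrite inE/= in_itv/= /uniform_pdf => /andP[x0 x1].
    by rewrite (ltW x0) (ltW x1)/= subr0 invr1.
  by rewrite integral_cst//= mul1e lebesgue_measure_itv/= lte_fin ltr01 oppr0 adde0.
have PC0 : Pr (~` C) = 0%E by rewrite (probability_setC Pr)// PC subee.
split; last first.
  exists (~` C); split=> //; first exact: measurableC.
  by move=> w /= h Cw; apply: h; move: Cw; rewrite /C/= in_itv/= /unit_clip => ->.
split=> [|w|c c01]; [exact: measurableT_comp measurable_unit_clip _|exact: unit_clip_itv|].
rewrite -[RHS](uniform01_cdfr uU)//.
have PIC A : measurable A -> P[A] = P[A `&` C].
  move=> mA; rewrite -[in LHS](setUIDK A C) prob_setU; last 3 first.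
  - exact: measurableI.
  - exact: measurableD.
  - by apply/disj_set2P; rewrite predeqE => w; split=> //= -[[_ Cw] [_ /(_ Cw)]].
  rewrite [X in _ + X](_ : _ = 0) ?addr0//.
  apply/eqP; rewrite eq_le prob_ge0 andbT.
  have -> : 0 = P[~` C] by rewrite PC0.
  apply: le_prob; [exact: measurableD|exact: measurableC|].
  by move=> w [].
rewrite /cdfr PIC; last by apply: measurable_le_cst; exact: measurableT_comp measurable_unit_clip _.
rewrite [RHS]PIC; last exact: measurable_le_cst.
congr (fine (Pr _)); rewrite predeqE => w /=; rewrite /C/= in_itv/= /unit_clip.
by split=> -[+ CU]; rewrite CU.
Qed.

Lemma rich_randomizer m (Y : Omega -> m.-tuple R) : rich Pr -> measurable_fun setT Y ->
  exists V, randomizer V /\ independent Pr V Y.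
Proof.
move=> Pr_rich mY; have [U [uU UY]] := Pr_rich m (as_mfun mY).
exists (unit_clip \o U); split; first by have [] := uniform01_randomizer uU.
exact: (independent_comp measurable_unit_clip (@measurable_id _ _ setT) UY).
Qed.

(** Richness speaks of tuples of reals, so [T] is prepended to [X]; head and tail then recover the
    pair measurably. *)
Lemma rich_randomizer_pair n (X : Omega -> n.-tuple R) T :
  rich Pr -> measurable_fun setT X -> measurable_fun setT T ->
  exists V, randomizer V /\ independent Pr V (fun w => (T w, X w)).
Proof.
move=> Pr_rich mX mT.
have [V [rV VTX]] := rich_randomizer Pr_rich (measurable_cons mT mX).
exists V; split=> //.
pose g (t : n.+1.-tuple R) := (thead t, [tuple of behead t]).
have mg : measurable_fun setT g.
  apply: measurable_fun_pair; first exact: measurable_tnth.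
  apply/measurable_fun_tnthP => i.
  rewrite (_ : _ \o _ = fun t : n.+1.-tuple R => tnth t (lift ord0 i)).
    exact: measurable_tnth.
  apply/funext => t /=; rewrite tnth_behead; congr tnth; apply: val_inj.
  by rewrite /= inordK// ltnS.
have -> : (fun w => (T w, X w)) =
    g \o (fun w => [the n.+1.-tuple R of T w :: X w]).
  apply/funext => w; rewrite /g /= theadE; congr pair.
  by apply: val_inj.
exact: (independent_comp (@measurable_id _ _ setT) mg VTX).
Qed.

(** The copy is the quantile transform of [V]: [quantile_le] identifies its law, and as a function
    of [V] it inherits independence of [Y]. *)
Lemma quantile_copy {d'} {S : measurableType d'} (Y : Omega -> S) V T :
  measurable_fun setT T -> randomizer V -> independent Pr V Y ->
  exists T' : {RV Pr >-> R}, (forall x, F T' x = F T x) /\ independent Pr T' Y.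
Proof.
move=> mT [mV V01 FV] VY.
pose q (u : R) : R := if 0 < u < 1 then quantile Pr T u else 0.
have mq : measurable_fun setT q.
  apply: (measurability (@RGenOInfty.G R)) => [|_ [_ [x ->] <-]].
    exact: RGenOInfty.measurableE.
  rewrite setTI.
  (* Inside ]0, 1[ the quantile exceeds [x] exactly above [F T x]; outside, [q] has the default
     value 0, which exceeds [x] exactly when [x < 0]. *)
  have -> : q @^-1` `]x, +oo[%classic =
     `]Num.max 0 (F T x), 1[%classic `|` (~` `]0, 1[%classic `&` [set _ | x < 0]).
    rewrite predeqE => u; rewrite /= !in_itv/= andbT /q gt_max.
    case: ifPn => u01; last first.
      split=> [x0|[/andP[/andP[u0 _] u1]|[]//]]; first by right; split=> //; exact/negP.
      by move: u01; rewrite u0 u1.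
    rewrite (ltNge x) quantile_le// -ltNge; case/andP: u01 => u0 u1; rewrite u0 u1/= andbT.
    by split=> [|[//|[]//]]; left.
  apply: measurableU => //; apply: measurableI; first exact: measurableC.
  have [x0|x0] := ltP x 0.
    by rewrite (_ : [set _ | _] = setT)// predeqE.
  by rewrite (_ : [set _ | _] = set0)// predeqE.
have mqV : measurable_fun setT (q \o V) by exact: measurableT_comp.
exists (as_mfun mqV); split; last exact: (independent_comp mq (@measurable_id _ _ setT) VY).
move=> x; rewrite -[RHS]FV ?cdfr_itv//; congr (fine (Pr _)); rewrite predeqE => w /=.
by rewrite /q V01 quantile_le.
Qed.

Lemma cdfr_identically_distributed (T T' : {RV Pr >-> R}) :
  (forall x, F T' x = F T x) -> identically_distributed T' T.
Proof.
move=> TT' A mA; apply: (law_ext _ mA) => x.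
rewrite -[LHS]/(Pr [set w | T' w <= x]) -[RHS]/(Pr [set w | T w <= x]).
rewrite -prob_fineK; last exact: measurable_le_cst.
by rewrite -[RHS]prob_fineK ?[X in X%:E](TT' x)//; exact: measurable_le_cst.
Qed.

Definition distributional_transform T V w : R :=
  G T (T w) + V w * (F T (T w) - G T (T w)).

Lemma distributional_transform_itv T V : measurable_fun setT T -> randomizer V ->
  forall w, G T (T w) <= distributional_transform T V w <= F T (T w).
Proof.
move=> mT [_ V01 _] w; rewrite /distributional_transform.
have := cdfl_le_cdfr Pr mT (T w); have /andP[] := V01 w; move: (F _ _) (G _ _) (V w).
by move=> f g v *; apply/andP; split; nra.
Qed.

Lemma measurable_cdfr T : measurable_fun setT T -> measurable_fun setT (F T).
Proof. by move=> mT; apply: nondecreasing_measurable => // x y; exact: cdfr_homo. Qed.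

Lemma measurable_cdfl T : measurable_fun setT T -> measurable_fun setT (G T).
Proof. by move=> mT; apply: nondecreasing_measurable => // x y; exact: cdfl_homo. Qed.

Lemma measurable_distributional_transform T V :
  measurable_fun setT T -> randomizer V ->
  measurable_fun setT (distributional_transform T V).
Proof.
move=> mT [mV _ _].
have mFT : measurable_fun setT (F T \o T) by apply: measurableT_comp => //; exact: measurable_cdfr.
have mGT : measurable_fun setT (G T \o T) by apply: measurableT_comp => //; exact: measurable_cdfl.
by apply: measurable_funD => //; apply: measurable_funM => //; exact: measurable_funB.
Qed.

(** Let [t] be the [c]-quantile of [T] and [a] the mass of its atom there. The event [S] adds to
    [T < t] the part [V <= r] of the atom, with [r] chosen so that [S] has probability exactly [c].
    It contains [W < c] and is contained in [W <= c]. *)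
Lemma distributional_transform_uniform T V
  (mW : measurable_fun setT (distributional_transform T V)) :
  measurable_fun setT T -> randomizer V -> independent Pr V T ->
  uniform01 (as_mfun mW : {RV Pr >-> R}).
Proof.
move=> mT rV VT; have WGF := distributional_transform_itv mT rV.
have [mV V01 FV] := rV.
apply: uniform01P => [w|c c01].
  by have := WGF w; have := cdfr_itv Pr mT (T w); have := cdfl_itv Pr mT (T w); lra.
set W := distributional_transform T V in mW WGF *.
pose t := quantile Pr T c.
have Gc : G T t <= c by exact: cdfl_quantile.
have cF : c <= F T t by rewrite -quantile_le.
pose a := P[[set w | T w = t]].
have FGa : F T t = G T t + a by rewrite cdfr_atom.
have a0 : 0 <= a by exact: prob_ge0.
have [r r01 ra] : exists2 r, 0 <= r <= 1 & r * a = c - G T t.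
  (* Without an atom [G T t = c] already, so [r = 1] does as well as any other value. *)
  have [a00|a00] := eqVneq a 0; first by exists 1; [rewrite ler01 lexx|lra].
  have a_gt0 : 0 < a by rewrite lt_neqAle eq_sym a00.
  exists ((c - G T t) / a); last by rewrite divfK.
  by rewrite divr_ge0 ?subr_ge0//= ler_pdivrMr// mul1r; lra.
pose S := [set w | T w < t] `|` ([set w | V w <= r] `&` [set w | T w = t]).
have mTt : measurable [set w | T w = t].
  by have := mT measurableT _ (measurable_set1 t); rewrite setTI.
have mTlt := measurable_lt_cst t mT.
have mVr := measurable_le_cst r mV.
have mVT : measurable ([set w | V w <= r] `&` [set w | T w = t]) by exact: measurableI.
have mS : measurable S by exact: measurableU.
have PS : P[S] = c.
  rewrite prob_setU//; last first.
    by apply/disj_set2P; rewrite predeqE => w; split=> //= -[/[swap] -[_ ->]]; rewrite ltxx.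
  have -> : P[[set w | V w <= r] `&` [set w | T w = t]] = F V r * a.
    have := VT _ _ (measurable_itv `]-oo, r]) (measurable_set1 t).
    rewrite -[V @^-1` _]/[set w | V w <= r] -[T @^-1` _]/[set w | T w = t] => ->.
    by rewrite fineM ?fin_num_measure.
  by rewrite FV// ra -/(G T t); lra.
rewrite -[X in _ <= X <= _]PS; apply/andP; split; apply: le_prob => //.
- exact: measurable_lt_cst.
- move=> w /= Wc; have [Tt|Tt|Tt] := ltgtP (T w) t; first by left.
  + by have := WGF w; have := cdfr_le_cdfl Pr mT Tt; lra.
  + right; split=> //=; rewrite leNgt; apply/negP => rV'.
    move: Wc; rewrite /W /distributional_transform Tt FGa => Wc.
    by nra.
- exact: measurable_le_cst.
- move=> w /= [Tt|[Vr Tt]].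
    by have := WGF w; have := cdfr_le_cdfl Pr mT Tt; lra.
  by rewrite /W /distributional_transform Tt FGa /=; have := ler_wpM2r a0 Vr; lra.
Qed.

End uniform_randomization.

(** * The stop-loss transform *)

Lemma indic_bool {S : Type} {R : realType} (b : S -> bool) s :
  \1_[set x | b x] s = (b s)%:R :> R.
Proof. by rewrite indicE; congr (nat_of_bool _)%:R; apply/idP/idP; rewrite inE. Qed.

Section stop_loss.
Context {d : measure_display} {Omega : measurableType d} {R : realType}.
Variable Pr : probability Omega R.
Implicit Types (V : Omega -> R).
Local Notation E := (Rintegral Pr setT).
Local Notation F := (cdfr Pr).
Local Notation G := (cdfl Pr).

Definition stop_loss V c := E (fun w => Num.max 0 (c - V w)).

Variable V : Omega -> R.
Hypotheses (mV : measurable_fun setT V) (V0 : forall w, 0 <= V w).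

Lemma bounded_stop_loss c : bounded_measurable (fun w => Num.max 0 (c - V w)).
Proof.
apply: (@itv_bounded_measurable _ _ _ _ 0 (Num.max 0 c)).
  by apply: measurable_maxr => //; exact: measurable_funB.
move=> w; rewrite le_max lexx/= ge_max le_max lexx/= le_max; apply/orP; right.
by rewrite gerBl.
Qed.

Lemma stop_loss_ge0 c : 0 <= stop_loss V c.
Proof. by apply: Rintegral_ge0 => w _; rewrite le_max lexx. Qed.

(** From [c] to [c + e] the positive part grows by [e] where [V <= c], by an amount in [0, e]
    elsewhere, and not at all where [V >= c + e]. This lemma and the next confine the slope of the
    transform between [F V c] and [G V (c + e)]. *)
Lemma stop_loss_incr_ge c e : 0 <= e -> e * F V c <= stop_loss V (c + e) - stop_loss V c.
Proof.
move=> e0; have mVc := measurable_le_cst c mV.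
have bI := bounded_measurable_indic mVc.
rewrite /cdfr /cdfl -(mean_indic _ mVc) -meanZ// -meanB; [|exact: bounded_stop_loss..].
apply: le_mean => [||w]; first exact: bounded_measurableZ.
  by apply: bounded_measurableB; exact: bounded_stop_loss.
rewrite indic_bool; have [Vc|Vc] := leP (V w) c.
  by rewrite mulr1 !max_r; lra.
by rewrite mulr0 (max_l (_ : c - V w <= 0)) ?subr0 ?le_max ?lexx//; lra.
Qed.

Lemma stop_loss_incr_le c e : 0 <= e -> stop_loss V (c + e) - stop_loss V c <= e * G V (c + e).
Proof.
move=> e0; have mVc := measurable_lt_cst (c + e) mV.
have bI := bounded_measurable_indic mVc.
rewrite /cdfr /cdfl -(mean_indic _ mVc) -meanZ// -meanB; [|exact: bounded_stop_loss..].
apply: le_mean => [||w]; last 2 first.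
- exact: bounded_measurableZ.
- rewrite indic_bool; have [Vc|Vc] := ltP (V w) (c + e).
    rewrite mulr1 (max_r (_ : 0 <= c + e - V w)); last lra.
    by rewrite lerBlDr -lerBlDl le_max; apply/orP; right; lra.
  by rewrite mulr0 !max_l; lra.
- by apply: bounded_measurableB; exact: bounded_stop_loss.
Qed.

Lemma stop_loss_homo : {homo stop_loss V : x y / x <= y}.
Proof.
move=> x y xy; rewrite -subr_ge0.
have -> : y = x + (y - x) by lra.
apply: le_trans (stop_loss_incr_ge _ _); last by rewrite subr_ge0.
by rewrite mulr_ge0 ?subr_ge0//; have /andP[] := cdfr_itv Pr mV x.
Qed.

Lemma stop_loss_lip x y : `|stop_loss V x - stop_loss V y| <= `|x - y|.
Proof.
wlog xy : x y / x <= y.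
  by move=> h; have [/h//|/ltW/h] := leP x y; rewrite distrC (distrC y).
rewrite distrC ger0_norm ?subr_ge0 ?stop_loss_homo// distrC ger0_norm ?subr_ge0//.
have {1}-> : y = x + (y - x) by lra.
apply: le_trans (stop_loss_incr_le _ _) _; rewrite ?subr_ge0//.
by rewrite ler_piMr ?subr_ge0//; have /andP[] := cdfl_itv Pr mV (x + (y - x)).
Qed.

(* Riemann sums: over a step of length [e] from [c], both the stop-loss transform
   of a uniform variable and [c ^+ 2 / 2] increase by [e * c] up to [e ^+ 2]. *)
Lemma stop_loss_randomizer c : randomizer Pr V -> 0 <= c <= 1 ->
  stop_loss V c = c ^+ 2 / 2.
Proof.
move=> [_ V01 FV] /andP[c0 c1].
have stop0 : stop_loss V 0 = 0.
  rewrite /stop_loss -[RHS](mean_cst Pr); apply: eq_Rintegral => w _.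
  by rewrite max_l// sub0r oppr_le0.
have step (k n : nat) : (k <= n.+1)%N ->
    `|stop_loss V (k%:R * (c / n.+1%:R)) - (k%:R * (c / n.+1%:R)) ^+ 2 / 2|
    <= k%:R * (c / n.+1%:R) ^+ 2.
  set e := c / n.+1%:R; have e0 : 0 <= e by rewrite divr_ge0.
  elim: k => [_|k IH kn]; first by rewrite !mul0r stop0 expr0n/= mul0r subrr normr0.
  have {IH} := IH (ltnW kn); rewrite !ler_norml => /andP[IH1 IH2].
  have ke1 : k.+1%:R * e <= 1.
    rewrite /e mulrCA mulrA ler_pdivrMr// mul1r.
    by rewrite (le_trans (ler_wpM2r _ c1))// mul1r ler_nat.
  have ke0 : 0 <= k%:R * e by rewrite mulr_ge0.
  have kS : k.+1%:R * e = k%:R * e + e by rewrite -natr1 mulrDl mul1r.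
  rewrite !kS -natr1 mulrDl mul1r.
  rewrite kS in ke1.
  have := stop_loss_incr_ge (k%:R * e) e0; have := stop_loss_incr_le (k%:R * e) e0.
  have := cdfl_le_cdfr Pr mV (k%:R * e + e).
  rewrite !FV; [|lra..] => Fle Sle Sge.
  have : e * G V (k%:R * e + e) <= e * (k%:R * e + e) by exact: ler_wpM2l.
  move: (stop_loss V (k%:R * e + e)) (stop_loss V (k%:R * e)) IH1 IH2 Sle Sge => s t.
  move: (k%:R * e) (G _ _) => x g.
  by move=> *; apply/andP; split; nra.
(* The accumulated error of [n + 1] steps of length [c / (n + 1)] is [c ^+ 2 / (n + 1)], below [e]
   for a suitable [n]. *)
apply/eqP; rewrite -subr_eq0 -normr_le0; apply/ler_addgt0Pr => e e0; rewrite add0r.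
have [n ne] := ltr_add_invr e0; rewrite add0r in ne.
have := step n.+1 n (leqnn _); rewrite !(mulrCA n.+1%:R) divff ?mulr1// => /le_trans; apply.
rewrite (le_trans _ (ltW ne))// mulrAC ler_pdivrMr// mulVf//.
by rewrite mulr_ile1.
Qed.

(** Over a step [r], the difference quotients of [c ^+ 2 / 2] are [c + r / 2] and [c - r / 2]; they
    bound [F V c] from above and [G V c] from below. Taking minima with [1 - c] and [c] keeps the
    step inside [0, 1]. *)
Lemma stop_loss_uniform01 : (forall w, 0 <= V w <= 1) ->
  (forall c, 0 <= c <= 1 -> stop_loss V c = c ^+ 2 / 2) ->
  uniform01 (as_mfun mV : {RV Pr >-> R}).
Proof.
move=> V01 SV; apply: uniform01P => // c /andP[c0 c1].
apply/andP; split; apply/ler_addgt0Pr => e e0; rewrite -/(F V c) -/(G V c).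
  pose r := Num.min e (1 - c).
  have r0 : 0 < r by rewrite lt_min e0 subr_gt0.
  have re : r <= e by rewrite ge_min lexx.
  have r1 : r <= 1 - c by rewrite ge_min lexx orbT.
  have := stop_loss_incr_ge c (ltW r0).
  have GF := cdfl_le_cdfr Pr mV c.
  rewrite !SV; [|lra..] => h.
  have : r * F V c <= r * (c + r) by nra.
  by rewrite ler_pM2l//; lra.
pose r := Num.min e c.
have r0 : 0 < r by rewrite lt_min e0.
have re : r <= e by rewrite ge_min lexx.
have r1 : r <= c by rewrite ge_min lexx orbT.
have := stop_loss_incr_le (c - r) (ltW r0).
have GF := cdfl_le_cdfr Pr mV c; rewrite subrK.
rewrite !SV; [|lra..] => h.
have : r * (c - r) <= r * G V c by nra.
by rewrite ler_pM2l//; lra.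
Qed.

Lemma mean_randomizer : randomizer Pr V -> E V = 2^-1.
Proof.
move=> rV; have [_ V01 _] := rV.
have V01' w : 0 <= V w <= 1 by have := V01 w; lra.
have bV := itv_bounded_measurable mV V01'.
have : E (fun w => 1 - V w) = 2^-1.
  rewrite -[RHS]mul1r -[X in X / _](expr1n _ 2) -stop_loss_randomizer ?ler01 ?lexx//.
  by apply: eq_Rintegral => w _; rewrite max_r//; have := V01' w; lra.
by rewrite meanB// ?mean_cst; [lra|exact: bounded_measurable_cst].
Qed.

End stop_loss.

(** * Splitting mass along tangent lines *)

Section refinement.
Context {d : measure_display} {Omega : measurableType d} {R : realType}.
Variable Pr : probability Omega R.
Hypothesis Pr_rich : rich Pr.
Context {n : nat} (X : Omega -> n.-tuple R).
Hypothesis mX : measurable_fun setT X.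
Implicit Types (U V W : Omega -> R).
Local Notation E := (Rintegral Pr setT).
Local Notation F := (cdfr Pr).
Local Notation S := (stop_loss Pr).

(** For [u] uniform, a point [v] of ]a, b[ goes to [b] with probability [(v - a) / (b - a)], the
    weight that keeps its mean at [v]. *)
Definition split_interval (a b u v : R) : R :=
  if a < v < b then if u * (b - a) <= v - a then b else a else v.

Lemma split_interval_itv a b u v : a < b ->
  Num.min a v <= split_interval a b u v <= Num.max b v.
Proof.
move=> ab; rewrite /split_interval; case: ifPn => [/andP[av vb]|_].
  by rewrite ge_min le_max; case: ifPn => _; rewrite !lexx ?(ltW ab)/= ?orbT.
by rewrite ge_min le_max lexx !orbT.
Qed.

(** Truncation to [0, 1] makes integrands bounded on their whole domain, as [independent_fubini]
    demands, and is the identity on the values that occur. *)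
Let clip (x : R) : R := Num.max 0 (Num.min 1 x).

Let clip_id x : 0 <= x <= 1 -> clip x = x.
Proof. by move=> /andP[x0 x1]; rewrite /clip min_r// max_r. Qed.

Let clip_itv x : 0 <= clip x <= 1.
Proof. by rewrite /clip le_max lexx ge_max ler01 ge_min lexx. Qed.

(** The randomizer [U] is integrated out with [(V, X)] frozen. A general [f] serves both the
    conditional means and the stop-loss transforms; [A] localizes on events of [X]. *)
Lemma mean_split_interval V U a b (f : R -> R) M (A : set (n.-tuple R)) :
  measurable_fun setT V -> (forall w, 0 <= V w <= 1) ->
  randomizer Pr U -> independent Pr U (fun w => (V w, X w)) ->
  0 <= a -> a < b -> b <= 1 ->
  measurable_fun setT f -> (forall v, 0 <= v <= 1 -> 0 <= f v <= M) ->
  measurable A ->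
  E (fun w => f (split_interval a b (U w) (V w)) * \1_A (X w)) =
  E (fun w => (if a < V w < b then ((b - V w) * f a + (V w - a) * f b) / (b - a)
               else f (V w)) * \1_A (X w)).
Proof.
move=> mV V01 [mU U01 FU] UVX a0 ab b1 mf f0M mA.
have V'01 u v : 0 <= v <= 1 -> 0 <= split_interval a b u v <= 1.
  move=> /andP[v0 v1]; have /andP[h1 h2] := split_interval_itv u v ab.
  by rewrite (le_trans _ h1) ?(le_trans h2)// ?ge_max ?le_min ?b1 ?a0.
pose g (z : R * (R * n.-tuple R)) :=
  f (clip (split_interval a b z.1 z.2.1)) * \1_A z.2.2.
have mg : measurable_fun setT g.
  apply: measurable_funM; last first.
    apply: measurableT_comp; first exact: measurable_indic.
    exact: (measurableT_comp measurable_snd measurable_snd).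
  apply: measurableT_comp => //; apply: measurable_maxr => //; apply: measurable_minr => //.
  have m1 : measurable_fun setT (fun z : R * (R * n.-tuple R) => z.1) by exact: measurable_fst.
  have m2 : measurable_fun setT (fun z : R * (R * n.-tuple R) => z.2.1).
    exact: (measurableT_comp measurable_fst measurable_snd).
  apply: measurable_fun_ifT => //.
    by apply: measurable_and; apply: measurable_fun_ltr.
  apply: measurable_fun_ifT => //; apply: measurable_fun_ler.
    by apply: measurable_funM.
  by apply: measurable_funB.
have gM z : 0 <= g z <= M.
  have /andP[h0 h1] := f0M _ (clip_itv (split_interval a b z.1 z.2.1)).
  rewrite /g indicE; case: (_ \in _); rewrite ?mulr1 ?mulr0 ?h0 ?h1//.
  by rewrite lexx (le_trans h0).
transitivity (E (fun w => g (U w, (V w, X w)))).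
  by apply: eq_Rintegral => w _; rewrite /g/= clip_id// V'01.
rewrite (independent_fubini _ _ UVX mg gM)//; last exact: measurable_fun_pair.
apply: eq_Rintegral => w _; rewrite /g/=; set v := V w; set x := X w.
have v01 : 0 <= v <= 1 := V01 w.
rewrite (@eq_Rintegral _ _ _ _ _ (fun w' => \1_A x * f (split_interval a b (U w') v))); last first.
  by move=> w' _; rewrite clip_id ?V'01// mulrC.
rewrite /split_interval; case: ifPn => avb; last by rewrite mean_cst mulrC.
have ba0 : 0 < b - a by rewrite subr_gt0.
pose p := (v - a) / (b - a).
have p01 : 0 <= p <= 1.
  by rewrite /p divr_ge0 ?subr_ge0 ?ler_pdivrMr ?mul1r//; lra.
have mUp := measurable_le_cst p mU.
have bI := bounded_measurable_indic mUp.
rewrite (@eq_Rintegral _ _ _ _ _ (fun w' => \1_A x * f a +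
   (\1_A x * (f b - f a)) * \1_[set w | U w <= p] w')); last first.
  move=> w' _; rewrite indic_bool /p ler_pdivlMr//; case: ifPn => _ /=; ring.
rewrite meanD; [|exact: bounded_measurable_cst|exact: bounded_measurableZ].
rewrite mean_cst meanZ// mean_indic// -/(F U p) FU// /p.
by field; rewrite gt_eqF.
Qed.

Definition stop_loss_dominated V := [/\ measurable_fun setT V, forall w, 0 <= V w <= 1 &
  forall c, 0 <= c <= 1 -> S V c <= c ^+ 2 / 2].

(** The middle clause says that both variables have the same conditional mean given [X]. By the last
    one, a point where the bound [c ^+ 2 / 2] is attained keeps this property under further
    refinement. *)
Definition refines V V' := [/\ stop_loss_dominated V',
  forall A, measurable A -> E (fun w => V' w * \1_A (X w)) = E (fun w => V w * \1_A (X w)) &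
  forall c, 0 <= c <= 1 -> S V c <= S V' c].

Lemma refines_trans V1 V2 V3 : refines V1 V2 -> refines V2 V3 -> refines V1 V3.
Proof.
move=> [_ m12 s12] [sV3 m23 s23]; split=> // [A mA|c c01]; first by rewrite m23 ?m12.
by rewrite (le_trans (s12 c c01)) ?s23.
Qed.

Lemma refines_tight V V' c : refines V V' -> 0 <= c <= 1 -> S V c = c ^+ 2 / 2 ->
  S V' c = c ^+ 2 / 2.
Proof.
move=> [[_ _ sV'] _ sVV'] c01 Vc; apply/eqP; rewrite eq_le sV'//=.
by rewrite -Vc sVV'.
Qed.

(* The line [c |-> t * c - t ^+ 2 / 2] is the tangent at [t] of [c ^+ 2 / 2]; moving
   the mass of the interval where it exceeds [S V] to the endpoints of that interval
   replaces [S V] by the maximum of the two. *)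
Lemma split_refines V a b t : stop_loss_dominated V -> 0 <= a -> a < t -> t < b -> b <= 1 ->
  S V a = t * a - t ^+ 2 / 2 -> S V b = t * b - t ^+ 2 / 2 ->
  exists V', [/\ refines V V', S V' t = t ^+ 2 / 2,
    (forall w, ~~ (a < V w < b) -> V' w = V w) &
    (forall w, a < V w < b -> a <= V' w <= b)].
Proof.
move=> [mV V01 sV] a0 at_ tb b1 Sa Sb; have ab := lt_trans at_ tb.
have [U [rU UVX]] := rich_randomizer_pair Pr_rich mX mV.
have [mU U01 FU] := rU.
pose V' w := split_interval a b (U w) (V w).
have mV' : measurable_fun setT V'.
  apply: measurable_fun_ifT => //.
    by apply: measurable_and; apply: measurable_fun_ltr.
  apply: measurable_fun_ifT => //; apply: measurable_fun_ler.
    by apply: measurable_funM.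
  by apply: measurable_funB.
have V'01 w : 0 <= V' w <= 1.
  have /andP[h1 h2] := split_interval_itv (U w) (V w) ab; have /andP[v0 v1] := V01 w.
  by rewrite (le_trans _ h1) ?(le_trans h2)// ?ge_max ?le_min ?b1 ?a0.
have V0 w : 0 <= V w by have /andP[] := V01 w.
have V'0 w : 0 <= V' w by have /andP[] := V'01 w.
have ba0 : 0 < b - a by rewrite subr_gt0.
pose f (c v : R) : R := Num.max 0 (c - v).
(* [K c v] is the mean of [f c] of the split variable given [V = v]. For [c] outside ]a, b[, [f c]
   is affine on [a, b] and splitting changes nothing; for [c] in [a, b], [K c v] interpolates
   linearly in [c] between [f a v] and [f b v]. *)
pose K (c v : R) : R :=
  if a < v < b then ((b - v) * f c a + (v - a) * f c b) / (b - a) else f c v.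
have SV' c : 0 <= c <= 1 -> S V' c = E (fun w => K c (V w)).
  move=> c01; have := @mean_split_interval V U a b (f c) 1 setT mV V01 rU UVX a0 ab b1.
  rewrite indicT /=.
  have -> : S V' c = E (fun w => f c (V' w) * 1) by apply: eq_Rintegral => w _; rewrite mulr1.
  have -> : E (fun w => K c (V w)) = E (fun w => K c (V w) * 1).
    by apply: eq_Rintegral => w _; rewrite mulr1.
  apply => //; first by apply: measurable_maxr => //; exact: measurable_funB.
  by move=> v v01; rewrite /f le_max lexx ge_max ler01/=; lra.
have K_out c v : c <= a \/ b <= c -> K c v = f c v.
  move=> cab; rewrite /K; case: ifPn => // /andP[av vb].
  rewrite /f; case: cab => [ca|bc].
    by rewrite !max_l; [|lra..]; rewrite !mulr0 addr0 mul0r.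
  rewrite !max_r; [|lra..]; rewrite -[RHS](mulfK (lt0r_neq0 ba0)); congr (_ / _); ring.
have K_in c v : a <= c <= b -> K c v = (b - c) / (b - a) * f a v + (c - a) / (b - a) * f b v.
  move=> /andP[ac cb]; rewrite /K; case: ifPn => [/andP[av vb]|].
    rewrite /f (max_l (_ : c - b <= 0)) ?(max_l (_ : a - v <= 0)); [|lra..].
    rewrite !max_r; [|lra..]; field; exact: lt0r_neq0.
  rewrite negb_and -!leNgt => /orP[va|bv].
    rewrite /f !max_r; [|lra..]; field; exact: lt0r_neq0.
  by rewrite /f !max_l; [|lra..]; rewrite !mulr0 addr0.
have S_out c : 0 <= c <= 1 -> c <= a \/ b <= c -> S V' c = S V c.
  by move=> c01 cab; rewrite SV'//; apply: eq_Rintegral => w _; rewrite K_out.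
(* At [a] and [b] the transform lies on the tangent, hence so does its linear interpolation. *)
have S_in c : a <= c <= b -> S V' c = t * c - t ^+ 2 / 2.
  move=> acb; rewrite SV'; last by move/andP: acb => [? ?]; apply/andP; split; lra.
  rewrite (@eq_Rintegral _ _ _ _ _ (fun w => (b - c) / (b - a) * f a (V w) +
    (c - a) / (b - a) * f b (V w))); last by move=> w _; rewrite K_in.
  rewrite meanD; [|by apply: bounded_measurableZ; exact: bounded_stop_loss..].
  rewrite !meanZ; [|exact: bounded_stop_loss..].
  rewrite -/(S V a) -/(S V b) Sa Sb; field; exact: lt0r_neq0.
exists V'; split; last 3 first.
- by rewrite S_in; [field|rewrite !ltW].
- by move=> w /negbTE h; rewrite /V' /split_interval h.
- move=> w avb; rewrite /V' /split_interval avb.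
  by case: ifPn => _; rewrite lexx ltW.
split.
- split=> // c c01; have [ca|ac] := leP c a; first by rewrite S_out ?sV//; left.
  have [bc|cb] := leP b c; first by rewrite S_out ?sV//; right.
  rewrite S_in; last by rewrite !ltW.
  (* The parabola exceeds its tangent at [t] by [(c - t) ^+ 2 / 2]. *)
  by rewrite -subr_ge0; have := sqr_ge0 (c - t); nra.
- move=> A mA; have := @mean_split_interval V U a b clip 1 A mV V01 rU UVX a0 ab b1.
  have -> : E (fun w => V' w * \1_A (X w)) = E (fun w => clip (V' w) * \1_A (X w)).
    by apply: eq_Rintegral => w _; rewrite clip_id.
  move=> ->//; last by apply: measurable_maxr => //; exact: measurable_minr.
  apply: eq_Rintegral => w _; congr (_ * _); case: ifPn => _; last by rewrite clip_id.
  rewrite !clip_id; [|lra..]; field; exact: lt0r_neq0.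
- move=> c c01; have [ca|ac] := leP c a; first by rewrite S_out//; left.
  have [bc|cb] := leP b c; first by rewrite S_out//; right.
  rewrite SV'//; apply: le_mean => [||w]; first exact: bounded_stop_loss.
    rewrite (_ : (fun w => _) = (fun w => (b - c) / (b - a) * f a (V w) +
      (c - a) / (b - a) * f b (V w))); last by apply/funext => w; rewrite K_in// !ltW.
    by apply: bounded_measurableD; apply: bounded_measurableZ; exact: bounded_stop_loss.
  (* Convexity of [f c]: on ]a, b[ it lies below its chord. *)
  rewrite /K; case: ifPn => // /andP[av vb]; rewrite /f.
  rewrite (max_l (_ : c - b <= 0)) ?(max_r (_ : 0 <= c - a)); [|lra..].
  rewrite mulr0 addr0 ge_max divr_ge0 ?mulr_ge0 ?subr_ge0 ?ler_pdivlMr//; try lra.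
  by nra.
Qed.

Lemma stop_loss_continuous V : measurable_fun setT V -> (forall w, 0 <= V w) ->
  continuous (S V).
Proof.
move=> mV V0 x; apply/cvgrPdist_le => e e0; near=> y.
apply: le_trans (stop_loss_lip _ mV V0 _ _) _.
by near: y; apply: cvgr_dist_le.
Unshelve. all: by end_near. Qed.

(** The excess [g] of [S V] over the tangent at the midpoint [t] is nonnegative at [l] and [r],
    where [S V] meets the parabola, and negative at [t] unless equality holds there already. The
    intermediate value theorem gives zeros [a] and [b] on either side of [t], between which the mass
    is split. *)
Lemma cell_refines V l r : stop_loss_dominated V -> 0 <= l -> l < r -> r <= 1 ->
  S V l = l ^+ 2 / 2 -> S V r = r ^+ 2 / 2 ->
  exists V', [/\ refines V V', S V' ((l + r) / 2) = ((l + r) / 2) ^+ 2 / 2,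
    (forall w, ~~ (l < V w < r) -> V' w = V w) &
    (forall w, l < V w < r -> l <= V' w <= r)].
Proof.
move=> sV l0 lr r1 Sl Sr; set t := (l + r) / 2.
have [lt tr] : l < t /\ t < r by rewrite /t; split; lra.
have [mV V01 sVphi] := sV.
have V0 w : 0 <= V w by have /andP[] := V01 w.
have [St|St] := eqVneq (S V t) (t ^+ 2 / 2).
  by exists V; split=> // w /andP[/ltW -> /ltW ->].
have {}St : S V t < t ^+ 2 / 2 by rewrite lt_neqAle St sVphi//; lra.
pose g c := S V c - (t * c - t ^+ 2 / 2).
have cg : continuous g.
  move=> c; apply: cvgB; first exact: stop_loss_continuous.
  by apply: cvgB; [apply: cvgMr; exact: cvg_id|exact: cvg_cst].
have gt0 : g t < 0 by rewrite /g; nra.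
have gl0 : 0 <= g l by rewrite /g Sl; have := sqr_ge0 (l - t); nra.
have gr0 : 0 <= g r by rewrite /g Sr; have := sqr_ge0 (r - t); nra.
have wcg x y : {within `[x, y], continuous g} by exact: continuous_subspaceT.
have [|a] := @IVT _ g l t 0 (ltW lt) (wcg _ _).
  by rewrite ge_min le_max (ltW gt0) gl0 orbT.
rewrite in_itv/= => /andP[la at_] ga.
have [|b] := @IVT _ g t r 0 (ltW tr) (wcg _ _).
  by rewrite ge_min le_max (ltW gt0) gr0 orbT.
rewrite in_itv/= => /andP[tb br] gb.
have {}at_ : a < t.
  by rewrite lt_neqAle at_ andbT; apply/negP => /eqP h; move: gt0; rewrite -h ga ltxx.
have {}tb : t < b.
  by rewrite lt_neqAle tb andbT; apply/negP => /eqP h; move: gt0; rewrite h gb ltxx.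
have [||||V' [V1 V2 V3 V4]] := @split_refines V a b t sV _ at_ tb.
- exact: le_trans la.
- exact: le_trans r1.
- by move: ga; rewrite /g; lra.
- by move: gb; rewrite /g; lra.
exists V'; split=> // w lVr.
  apply: V3; apply: contra lVr => /andP[aV Vb].
  by rewrite (le_lt_trans la)//= (lt_le_trans Vb).
have [/V4/andP[aV Vb]|/V3 ->] := boolP (a < V w < b).
  by rewrite (le_trans la)//= (le_trans Vb).
by case/andP: lVr => *; rewrite !ltW.
Qed.

Definition tight V N := forall i, (i <= N)%N -> S V (i%:R / N%:R) = (i%:R / N%:R) ^+ 2 / 2.

Lemma level_refines V N : stop_loss_dominated V -> (0 < N)%N -> tight V N ->
  exists V', [/\ refines V V', tight V' (N.*2) &
    forall w, `|V' w - V w| <= N%:R^-1].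
Proof.
move=> sV N0 tV; have N0' : 0 < N%:R :> R by rewrite ltr0n.
have itv j : (j <= N)%N -> 0 <= (j%:R / N%:R : R) <= 1.
  by move=> jN; rewrite divr_ge0//= ler_pdivrMr// mul1r ler_nat.
have mid j : j.+1%:R / N%:R = j%:R / N%:R + N%:R^-1 :> R by rewrite -natr1 mulrDl mul1r.
have Ninv : 0 < N%:R^-1 :> R by rewrite invr_gt0.
(* The cells are treated from left to right. Values beyond [j / N] are untouched and values up to
   [j / N] stay below it, so a point that the next cell moves is still at its original place; no
   point moves twice, and each stays within one mesh. *)
have cells j : (j <= N)%N -> exists V', [/\ refines V V',
    (forall w, j%:R / N%:R < V w -> V' w = V w),
    (forall w, V w <= j%:R / N%:R -> V' w <= j%:R / N%:R),
    (forall w, `|V' w - V w| <= N%:R^-1) &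
    (forall i, (i < j)%N -> S V' ((i%:R / N%:R + i.+1%:R / N%:R) / 2) =
       ((i%:R / N%:R + i.+1%:R / N%:R) / 2) ^+ 2 / 2)].
  elim: j => [_|j IH jN].
    by exists V; split=> // w; rewrite subrr normr0 ltW.
  have [V1 [rV1 up1 low1 dist1 mid1]] := IH (ltnW jN).
  have [sV1 _ _] := rV1.
  have /andP[j0 j1] := itv _ (ltnW jN); have /andP[j0' j1'] := itv _ jN.
  have [|||V2 [rV2 mid2 out2 in2]] := @cell_refines V1 (j%:R / N%:R) (j.+1%:R / N%:R) sV1 j0 _ j1'.
  - by rewrite mid ltrDl.
  - by apply: (refines_tight rV1) (tV _ _); [exact: itv (ltnW _)|exact: ltnW].
  - by apply: (refines_tight rV1) (tV _ _); [exact: itv|].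
  exists V2; split.
  - exact: refines_trans rV2.
  - move=> w jV; have jV' : j%:R / N%:R < V w by rewrite (lt_trans _ jV)// mid ltrDl.
    by rewrite out2 up1// negb_and -!leNgt (ltW jV) orbT.
  - move=> w Vj; have [/in2/andP[]//|/out2 ->] := boolP (j%:R / N%:R < V1 w < j.+1%:R / N%:R).
    have [jV|Vj'] := ltP (j%:R / N%:R) (V w); first by rewrite up1.
    by rewrite (le_trans (low1 _ Vj'))// mid lerDl ltW.
  - move=> w; have [h|/out2 ->//] := boolP (j%:R / N%:R < V1 w < j.+1%:R / N%:R).
    have jV : j%:R / N%:R < V w.
      rewrite ltNge; apply/negP => /low1; case/andP: h => h _.
      by rewrite leNgt h.
    move: (in2 _ h) (h); rewrite up1// mid => /andP[? ?] /andP[? ?].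
    by rewrite ler_norml; apply/andP; split; lra.
  - move=> i; rewrite ltnS leq_eqVlt => /predU1P[->//|ij].
    apply: (refines_tight rV2) (mid1 _ ij).
    have /andP[? ?] := itv i (leq_trans (ltnW ij) (ltnW jN)).
    have /andP[? ?] := itv i.+1 (leq_trans ij (ltnW jN)).
    by apply/andP; split; lra.
have [V' [rV' _ _ dV' midV']] := cells N (leqnn N).
exists V'; split=> // i iN.
have N2 : N.*2%:R = 2 * N%:R :> R by rewrite -mul2n natrM.
(* Odd indices of the finer grid are the midpoints just treated; even ones are old grid points,
   where tightness persists. *)
have := odd_double_half i; case: (odd i) => /= iE.
  have h : (i./2 < N)%N by lia.
  have -> : i%:R / N.*2%:R = (i./2%:R / N%:R + i./2.+1%:R / N%:R) / 2 :> R.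
    rewrite -{1}iE N2 -natr1 natrD -mul2n natrM; field; exact: lt0r_neq0.
  exact: midV'.
have h : (i./2 <= N)%N by lia.
have -> : i%:R / N.*2%:R = i./2%:R / N%:R :> R.
  rewrite -{1}iE N2 add0n -mul2n natrM; field; exact: lt0r_neq0.
by apply: (refines_tight rV'); [exact: itv|exact: tV].
Qed.

End refinement.

(** * Limit of the dyadic refinements *)

Lemma geometric_limit {R : realType} (u : R^nat) :
  (forall m, `|u m.+1 - u m| <= (2 ^ m)%:R^-1) ->
  exists l, forall m, `|l - u m| <= 2 * (2 ^ m)%:R^-1.
Proof.
(* The radius [r m] is the sum of the geometric tail, so the intervals with centre [u m] and radius
   [r m] are nested; the limit is the supremum of their left ends. *)
move=> uS; pose r m : R := 2 * (2 ^ m)%:R^-1.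
have r0 m : 0 <= r m by rewrite /r mulr_ge0.
have rS m : r m = r m.+1 + (2 ^ m)%:R^-1.
  have : (2 ^ m)%:R != 0 :> R by rewrite pnatr_eq0 expn_eq0.
  by rewrite /r expnS natrM => ?; field.
pose lo m := u m - r m; pose hi m := u m + r m.
have loS : nondecreasing_seq lo.
  apply/nondecreasing_seqP => m; rewrite /lo (rS m).
  by have := uS m; rewrite ler_norml => /andP[? ?]; lra.
have hiS : nonincreasing_seq hi.
  apply/nonincreasing_seqP => m; rewrite /hi (rS m).
  by have := uS m; rewrite ler_norml => /andP[? ?]; lra.
have lohi i j : lo i <= hi j.
  have := loS _ _ (leq_maxl i j); have := hiS _ _ (leq_maxr i j).
  by have := r0 (maxn i j); rewrite /lo /hi; lra.
exists (sup (range lo)) => m.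
have supP : has_sup (range lo).
  by split; [exists (lo 0), 0|exists (hi 0) => _ [i _ <-]].
have h1 : lo m <= sup (range lo) by apply: sup_upper_bound => //; exists m.
have h2 : sup (range lo) <= hi m by apply: ge_sup; [exact: supP.1|move=> _ [i _ <-]].
by rewrite ler_norml; move: h1 h2; rewrite /lo /hi -/(r m); lra.
Qed.

Lemma pow2_inv_small {R : realType} (c e : R) : 0 < e -> exists m, c * (2 ^ m)%:R^-1 <= e.
Proof.
move=> e0; exists (Num.trunc (c / e)).+1.
rewrite ler_pdivrMr ?ltr0n ?expn_gt0// mulrC -ler_pdivrMr//.
by rewrite (le_trans (ltW (truncnS_gt _)))// ler_nat ltnW// ltn_expl.
Qed.

Section uniform_refinement.
Context {d : measure_display} {Omega : measurableType d} {R : realType}.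
Variable Pr : probability Omega R.
Hypothesis Pr_rich : rich Pr.
Context {n : nat} (X : Omega -> n.-tuple R).
Hypothesis mX : measurable_fun setT X.
Local Notation E := (Rintegral Pr setT).
Local Notation S := (stop_loss Pr).

Lemma uniform_refinement V0 : stop_loss_dominated Pr V0 -> S V0 1 = 2^-1 ->
  exists V : {RV Pr >-> R}, [/\ uniform01 V, forall w, 0 <= V w <= 1 &
    forall A, measurable A ->
      E (fun w => V w * \1_A (X w)) = E (fun w => V0 w * \1_A (X w))].
Proof.
move=> sV0 SV01; have [mV0 V001 SV0] := sV0.
pose ok m (V : Omega -> R) := refines Pr X V0 V /\ tight Pr V (2 ^ m).
(* The grid of level 0 is {0, 1}: the transform vanishes at 0 by domination, and its value at 1 is a
   hypothesis. *)
have ok0 : ok 0 V0.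
  split=> // i; rewrite expn0 invr1 mulr1 leq_eqVlt => /predU1P[->|].
    by rewrite SV01 expr1n mul1r.
  rewrite ltnS leqn0 => /eqP ->; rewrite expr0n/= mul0r; apply/eqP.
  rewrite eq_le stop_loss_ge0 andbT -[leRHS](mul0r 2^-1) -[X in X * _](expr0n _ 2).
  by rewrite SV0// lexx ler01.
have okS m (V : {V | ok m V}) :
    {V' | ok m.+1 V' /\ forall w, `|V' w - sval V w| <= (2 ^ m)%:R^-1}.
  apply: cid; case: V => V [rV tV] /=; have [sV _ _] := rV.
  have N0 : (0 < 2 ^ m)%N by rewrite expn_gt0.
  have [V' [rV' tV' dV']] := level_refines Pr_rich mX sV N0 tV.
  exists V'; split=> //; split; first exact: refines_trans rV'.
  by rewrite expnS mul2n.
pose fix u m : {V | ok m V} :=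
  if m is m'.+1 then let V' := okS m' (u m') in exist _ (sval V') (svalP V').1
  else exist _ V0 ok0.
have uS m w : `|sval (u m.+1) w - sval (u m) w| <= (2 ^ m)%:R^-1.
  exact: (svalP (okS m (u m))).2.
have /choice[V dV] w : exists l, forall m, `|l - sval (u m) w| <= 2 * (2 ^ m)%:R^-1.
  exact: geometric_limit.
have okm m : [/\ refines Pr X V0 (sval (u m)), measurable_fun setT (sval (u m)),
    forall w, 0 <= sval (u m) w <= 1 & tight Pr (sval (u m)) (2 ^ m)].
  by have [[[mV V01 SV] mrt ref] tV] := svalP (u m).
have mV : measurable_fun setT V.
  apply: (@measurable_fun_cvg _ _ _ _ (fun m => sval (u m))) => [m|w _].
    by have [] := okm m.
  apply/cvgrPdist_le => e e0.
  have [k ke] := pow2_inv_small 2 e0.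
  near=> m; apply: le_trans (dV w m) _; apply: le_trans ke.
  rewrite ler_pM2l// lef_pV2 ?posrE ?ltr0n ?expn_gt0// ler_nat leq_exp2l//.
  by near: m; exact: nbhs_infty_ge.
have V01 w : 0 <= V w <= 1.
  apply/andP; split.
    rewrite -oppr_le0; apply/ler_addgt0Pr => e /(pow2_inv_small 2)[m me].
    have [_ _ /(_ w)/andP[h0 _] _] := okm m; have := dV w m.
    by rewrite ler_norml => /andP[h _]; lra.
  apply/ler_addgt0Pr => e /(pow2_inv_small 2)[m me].
  have [_ _ /(_ w)/andP[_ h1] _] := okm m; have := dV w m.
  by rewrite ler_norml => /andP[_ h]; lra.
have V0' w : 0 <= V w by have /andP[] := V01 w.
exists (as_mfun mV); split => //; last first.
  move=> A mA; apply/eqP; rewrite -subr_eq0 -normr_le0.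
  apply/ler_addgt0Pr => e /(pow2_inv_small 2)[m me]; rewrite add0r.
  have [[_ <-// _] mum u01 _] := okm m.
  have bA : bounded_measurable (fun w => \1_A (X w) : R).
    apply: (@itv_bounded_measurable _ _ _ _ 0 1) => [|w].
      by apply: measurableT_comp => //; exact: measurable_indic.
    by rewrite indicE; case: (_ \in _); rewrite ?lexx ler01.
  apply: mean_le_dist => [||w].
  - by apply: bounded_measurableM => //; exact: itv_bounded_measurable V01.
  - by apply: bounded_measurableM => //; exact: itv_bounded_measurable u01.
  - rewrite -mulrBl normrM (le_trans _ me)// (le_trans _ (dV w m))//.
    rewrite ler_piMr// indicE; case: (_ \in _); rewrite ?normr1 ?normr0//.
apply: stop_loss_uniform01 => // c /andP[c0 c1].
apply/eqP; rewrite -subr_eq0 -normr_le0.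
(* With [q] the grid point just below [c], the factor 4 collects one mesh for moving [S V] from [c]
   to [q], two for replacing [V] by its [m]-th approximation, and one for moving the parabola back
   to [c]. *)
apply/ler_addgt0Pr => e /(pow2_inv_small 4)[m me]; rewrite add0r.
have [_ mum u01 tu] := okm m.
have u0 w : 0 <= sval (u m) w by have /andP[] := u01 w.
have N0 : 0 < (2 ^ m)%:R :> R by rewrite ltr0n expn_gt0.
pose i := Num.trunc (c * (2 ^ m)%:R).
have cN0 : 0 <= c * (2 ^ m)%:R by rewrite mulr_ge0// ltW.
have /andP[ic ci] : i%:R <= c * (2 ^ m)%:R < i.+1%:R := truncn_itv cN0.
have iN : (i <= 2 ^ m)%N.
  by rewrite -(ler_nat R) (le_trans ic)// ler_piMl// ltW.
pose q : R := i%:R / (2 ^ m)%:R.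
have qc : q <= c by rewrite ler_pdivrMr.
have cq : c <= q + (2 ^ m)%:R^-1.
  by rewrite /q -[X in _ + X]mul1r -mulrDl natr1 ler_pdivlMr// ltW.
have q0 : 0 <= q by rewrite divr_ge0// ltW.
have h1 : `|S V c - S V q| <= c - q.
  by rewrite -[leRHS]ger0_norm ?subr_ge0//; exact: stop_loss_lip.
have h2 : `|S V q - S (sval (u m)) q| <= 2 * (2 ^ m)%:R^-1.
  apply: mean_le_dist => [||w]; [exact: bounded_stop_loss..|].
  by apply: le_trans (dV w m); rewrite !maxEle; do 2 case: ifPn; rewrite -?ltNge;
    move=> *; rewrite ler_norml; apply/andP; split; have := dV w m;
    have [?|?] := ler0P (V w - sval (u m) w); lra.
rewrite tu// -/q in h2.
move: h1 h2 me cq; set r := (2 ^ m)%:R^-1; rewrite !ler_norml => /andP[? ?] /andP[? ?] me cq.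
by apply/andP; split; nra.
Unshelve. all: by end_near. Qed.

End uniform_refinement.

(** * Conditional Jensen and conditional probabilities *)

Section concave_order.
Context {d : measure_display} {Omega : measurableType d} {R : realType}.
Variable Pr : probability Omega R.
Local Notation E := (Rintegral Pr setT).

(** Chord slopes decrease; the inequality is cleared of denominators, with [y] written as a
    barycentre of [x] and [z]. *)
Lemma concave_slope (f : R -> R) x y z : concave_function f -> x < y -> y < z ->
  (f z - f y) * (y - x) <= (f y - f x) * (z - y).
Proof.
move=> cf xy yz; have zx : 0 < z - x by lra.
set t := (z - y) / (z - x).
have t0 : 0 <= t by rewrite divr_ge0; lra.
have t1 : t <= 1 by rewrite ler_pdivrMr//; lra.
have : - f (t * x + (1 - t) * z) <= t * - f x + (1 - t) * - f z.
  exact: (cf (Itv01 t0 t1) x z (in_setT x) (in_setT z)).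
have -> : t * x + (1 - t) * z = y.
  by rewrite /t; field; exact: lt0r_neq0.
have -> : t * - f x + (1 - t) * - f z =
  (- f x * (z - y) - f z * (y - x)) / (z - x).
  by rewrite /t; field; exact: lt0r_neq0.
by rewrite ler_pdivlMr//; lra.
Qed.

Lemma bounded_homo (f : R -> R) (Z : Omega -> R) :
  {homo f : x y / x <= y} -> measurable_fun setT Z -> (forall w, 0 <= Z w <= 1) ->
  bounded_measurable (f \o Z).
Proof.
move=> hf mZ Z01; apply: (@itv_bounded_measurable _ _ _ _ (f 0) (f 1)).
  by apply: measurableT_comp => //; exact: nondecreasing_measurable.
by move=> w; have /andP[? ?] := Z01 w; rewrite /= !hf.
Qed.

(* Conditional Jensen by discretization: on [jh <= Z < (j+1)h], [f] lies below
   the chord through [jh - h] and [jh], raised by its increment, which is [O(h)]. *)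
Lemma le_mean_concave (f : R -> R) (W Z : Omega -> R) :
  {homo f : x y / x <= y} -> concave_function f ->
  measurable_fun setT W -> (forall w, 0 <= W w <= 1) ->
  measurable_fun setT Z -> (forall w, 0 <= Z w <= 1) ->
  (forall a b, E (fun w => W w * \1_[set w | a <= Z w < b] w) <=
               E (fun w => Z w * \1_[set w | a <= Z w < b] w)) ->
  E (f \o W) <= E (f \o Z).
Proof.
move=> hf cf mW W01 mZ Z01 WZ.
have bW := itv_bounded_measurable mW W01; have bZ := itv_bounded_measurable mZ Z01.
have bfW := bounded_homo hf mW W01; have bfZ := bounded_homo hf mZ Z01.
(* The slope of [f] over [-2, -1] bounds the slopes [s] of all chords used below: they start at
   [q - h >= -1/2], since [q >= 0] and [h <= 1/2]. *)
pose K := f (-1) - f (-2).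
have K0 : 0 <= K by rewrite subr_ge0; apply: hf; lra.
have mB a b : measurable [set w | a <= Z w < b].
  rewrite (_ : [set w | _] = ~` [set w | Z w < a] `&` [set w | Z w < b]).
    by apply: measurableI; [apply: measurableC|]; exact: measurable_lt_cst.
  rewrite predeqE => w /=; split=> [/andP[aZ Zb]|[/negP]]; last by rewrite -leNgt => -> ->.
  by split=> //; apply/negP; rewrite -leNgt.
have bB a b : bounded_measurable (\1_[set w | a <= Z w < b] : Omega -> R).
  exact: bounded_measurable_indic.
have approx h : 0 < h <= 2^-1 -> forall j : nat,
    E (fun w => f (W w) * \1_[set w | 0 <= Z w < j%:R * h] w) <=
    E (fun w => (f (Z w) + 2 * K * h) * \1_[set w | 0 <= Z w < j%:R * h] w).
  move=> /andP[h0 h12]; elim=> [|j IH].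
    rewrite mul0r; apply: le_mean; [exact: bounded_measurableM| |].
      apply: bounded_measurableM => //; apply: bounded_measurableD => //.
      exact: bounded_measurable_cst.
    move=> w; rewrite indic_bool.
    by have [/andP[? ?]|_] := boolP (0 <= Z w < 0); [lra|rewrite !mulr0].
  set q := j%:R * h; have q0 : 0 <= q by rewrite mulr_ge0// ltW.
  have qS : j.+1%:R * h = q + h by rewrite -natr1 mulrDl mul1r.
  rewrite qS; pose s := (f q - f (q - h)) / h.
  have s0 : 0 <= s by apply: divr_ge0; [rewrite subr_ge0; apply: hf; lra|exact: ltW].
  have sh : f q - f (q - h) = s * h by rewrite divfK// gt_eqF.
  have sK : s <= K.
    have h1 : (f q - f (q - h)) * (q - h + 1) <= (f (q - h) - f (-1)) * h.
      by have := @concave_slope f (-1) (q - h) q cf; rewrite opprK subKr; apply; lra.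
    have h2 : f (q - h) - f (-1) <= K * (q - h + 1).
      have := @concave_slope f (-2) (-1) (q - h) cf; rewrite !opprK -/K.
      have -> : -1 + 2 = 1 :> R by lra.
      by rewrite mulr1; apply; lra.
    have h3 : s * h * (q - h + 1) <= K * h * (q - h + 1).
      rewrite -sh (le_trans h1)// (le_trans (ler_wpM2r (ltW h0) h2))//.
      by rewrite mulrAC.
    by rewrite !ler_pM2r in h3 => //; lra.
  (* Outside [q - h, q] the chord line dominates [f] by concavity. Inside, [f y <= f q] by
     monotonicity, and the extra [s * h] makes up for the drop of the chord. *)
  have chord y : f y <= f q + s * (y - q) + s * h.
    have [qy|yq] := ltP q y.
      have := @concave_slope f (q - h) q y cf; rewrite subKr sh => /(_ _ qy) hy.
      have : (f y - f q) * h <= s * (y - q) * h by rewrite mulrAC; apply: hy; lra.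
      by rewrite ler_pM2r//; have := mulr_ge0 s0 (ltW h0); lra.
    have [qhy|yqh] := leP (q - h) y.
      have := hf _ _ yq; have : 0 <= s * (y - q + h) by rewrite mulr_ge0//; lra.
      lra.
    have := @concave_slope f y (q - h) q cf yqh; rewrite subKr sh => hy.
    have : s * (q - h - y) * h <= (f (q - h) - f y) * h by rewrite mulrAC; apply: hy; lra.
    by rewrite ler_pM2r//; have := mulr_ge0 s0 (ltW h0); lra.
  pose B := [set w | q <= Z w < q + h].
  have bBq : bounded_measurable (\1_B : Omega -> R) by exact: bB.
  have split_indic w : \1_[set w | 0 <= Z w < q + h] w =
      \1_[set w | 0 <= Z w < q] w + \1_B w :> R.
    rewrite !indic_bool; have /andP[-> _] /= := Z01 w.
    have [Zq|Zq] := ltP (Z w) q; first by rewrite (lt_trans Zq) ?addr0// ltrDl.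
    by rewrite add0r.
  rewrite (@eq_Rintegral _ _ _ _ _ (fun w => f (W w) * \1_[set w | 0 <= Z w < q] w +
    f (W w) * \1_B w)); last by move=> w _; rewrite split_indic mulrDr.
  rewrite [leRHS](@eq_Rintegral _ _ _ _ _ (fun w =>
     (f (Z w) + 2 * K * h) * \1_[set w | 0 <= Z w < q] w +
     (f (Z w) + 2 * K * h) * \1_B w)); last by move=> w _; rewrite split_indic mulrDr.
  have bfZK : bounded_measurable (fun w => f (Z w) + 2 * K * h).
    by apply: bounded_measurableD => //; exact: bounded_measurable_cst.
  rewrite meanD; [|exact: bounded_measurableM..].
  rewrite meanD; [|exact: bounded_measurableM..].
  apply: lerD => //.
  (* The majorant reads [c + s * y] with [s >= 0], so the comparison of [W] and [Z] on the cell
     carries over to it. *)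
  pose c := f q - s * q + s * h.
  have bW1 : bounded_measurable (fun w => c * \1_B w + s * (W w * \1_B w)).
    by apply: bounded_measurableD; apply: bounded_measurableZ => //; exact: bounded_measurableM.
  have bZ1 : bounded_measurable (fun w => c * \1_B w + s * (Z w * \1_B w)).
    by apply: bounded_measurableD; apply: bounded_measurableZ => //; exact: bounded_measurableM.
  apply: (@le_trans _ _ (E (fun w => c * \1_B w + s * (W w * \1_B w)))).
    apply: le_mean => //; first exact: bounded_measurableM.
    by move=> w; rewrite mulrA -mulrDl ler_wpM2r//; have := chord (W w); rewrite /c; lra.
  apply: (@le_trans _ _ (E (fun w => c * \1_B w + s * (Z w * \1_B w)))).
    have bWB : bounded_measurable (fun w => W w * \1_B w) by exact: bounded_measurableM.
    have bZB : bounded_measurable (fun w => Z w * \1_B w) by exact: bounded_measurableM.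
    rewrite meanD; [|exact: bounded_measurableZ..].
    rewrite meanD; [|exact: bounded_measurableZ..].
    by rewrite !meanZ// lerD2l ler_wpM2l// WZ.
  apply: le_mean => //; first exact: bounded_measurableM.
  (* On the cell [f q <= f (Z w)] and [Z w - q <= h], so the majorant exceeds [f (Z w)] by at most
     [2 * s * h]. *)
  move=> w; rewrite mulrA -mulrDl /B indic_bool.
  have [/andP[qZ Zq]|_] := boolP (q <= Z w < q + h); last by rewrite !mulr0.
  rewrite !mulr1; have := hf _ _ qZ; rewrite /c.
  have : s * (Z w - q) <= s * h by apply: ler_wpM2l => //; lra.
  have : s * h <= K * h by apply: ler_wpM2r => //; exact: ltW.
  lra.
apply/ler_addgt0Pr => e e0; pose h := Num.min (2^-1) (e / (2 * (K + 1))).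
have K1 : 0 < 2 * (K + 1) by lra.
have h0 : 0 < h by rewrite lt_min divr_gt0// invr_gt0 ltr0n.
have h2 : h <= 2^-1 by rewrite ge_min lexx.
have hK : 2 * K * h <= e.
  have : h <= e / (2 * (K + 1)) by rewrite ge_min lexx orbT.
  rewrite ler_pdivlMr//; nra.
have h01 : 0 < h <= 2^-1 by rewrite h0.
have := approx h h01 (Num.trunc h^-1).+1.
have all1 w : \1_[set w | 0 <= Z w < (Num.trunc h^-1).+1%:R * h] w = 1 :> R.
  rewrite indic_bool; have /andP[-> Z1] /= := Z01 w.
  rewrite (le_lt_trans Z1)//; rewrite -ltr_pdivrMr// mul1r.
  exact: truncnS_gt.
rewrite (@eq_Rintegral _ _ _ _ _ (f \o W)); last by move=> w _; rewrite all1 mulr1.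
rewrite [X in _ <= X -> _](@eq_Rintegral _ _ _ _ _ (fun w => f (Z w) + 2 * K * h)); last first.
  by move=> w _; rewrite all1 mulr1.
rewrite meanD//; last exact: bounded_measurable_cst.
by rewrite mean_cst => /le_trans; apply; rewrite lerD2l.
Qed.

Local Open Scope ereal_scope.

(** Positive and negative parts are compared separately, which covers infinite expectations. *)
Lemma le_expectation_ae (Y Z : Omega -> R) : measurable_fun setT Y -> measurable_fun setT Z ->
  {ae Pr, forall w, (Y w <= Z w)%R} -> 'E_Pr[Y] <= 'E_Pr[Z].
Proof.
move=> mY mZ YZ; rewrite unlock [leLHS]integralE [leRHS]integralE.
apply: leeB; apply: ae_ge0_le_integral => //;
  try by apply: measurable_funepos; exact/measurable_EFinP.
- apply: filterS YZ => w Yw _; rewrite !funeposE /=.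
  by rewrite ge_max !le_max lexx /= lee_fin Yw ?orbT.
- by apply: measurable_funeneg; exact/measurable_EFinP.
- by apply: measurable_funeneg; exact/measurable_EFinP.
- apply: filterS YZ => w Yw _; rewrite !funenegE /=.
  by rewrite ge_max !le_max lexx /= lee_fin lerN2 Yw ?orbT.
Qed.

Lemma expectation_mean (Z : Omega -> R) : bounded_measurable Z ->
  'E_Pr[Z] = (E Z)%:E.
Proof. by move=> bZ; rewrite unlock mean_fineK. Qed.

End concave_order.

Section conditioning.
Context {d : measure_display} {Omega : measurableType d} {R : realType}.
Variable Pr : probability Omega R.
Context {d' : measure_display} {S : measurableType d'} (X : Omega -> S).
Hypothesis mX : measurable_fun setT X.
Local Notation E := (Rintegral Pr setT).

Lemma sigma_preimage A : measurable A -> g_sigma_algebra_preimage X (X @^-1` A).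
Proof. by move=> mA; exists A => //; rewrite setTI. Qed.

Lemma sigma_preimage_ex B : g_sigma_algebra_preimage X B ->
  exists2 A, measurable A & B = X @^-1` A.
Proof. by move=> [A mA <-]; exists A => //; rewrite setTI. Qed.

Lemma sigma_measurable_set B : g_sigma_algebra_preimage X B -> measurable B.
Proof.
by move=> /sigma_preimage_ex[A mA ->]; rewrite -[X in measurable X]setTI; exact: mX.
Qed.

Lemma sigma_measurable_sub (Z : Omega -> R) C : sigma_measurable X Z -> measurable C ->
  g_sigma_algebra_preimage X (Z @^-1` C : set Omega).
Proof. by move=> mZ mC; have := mZ measurableT _ mC; rewrite setTI. Qed.

Lemma sigma_measurable_fun (Z : Omega -> R) :
  sigma_measurable X Z -> measurable_fun setT (Z : Omega -> R).
Proof.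
move=> mZ _ C mC; rewrite setTI; apply: sigma_measurable_set.
exact: sigma_measurable_sub.
Qed.

Lemma sigma_measurable_comp (Z : Omega -> R) (f : R -> R) : measurable_fun setT f ->
  sigma_measurable X Z -> sigma_measurable X (f \o Z).
Proof. by move=> mf mZ; exact: measurableT_comp. Qed.

(** The event [B] where [Y > Z] lies in the sigma-algebra of [X]; the integral of the positive
    function [Y - Z] over it is at most 0, so [B] is null. *)
Lemma le_ae_of_le_integral (Y Z : Omega -> R) :
  sigma_measurable X Y -> sigma_measurable X Z ->
  Pr.-integrable setT (EFin \o Y) -> Pr.-integrable setT (EFin \o Z) ->
  (forall B, g_sigma_algebra_preimage X B ->
    \int[Pr]_(w in B) (Y w)%:E <= \int[Pr]_(w in B) (Z w)%:E)%E ->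
  {ae Pr, forall w, Y w <= Z w}.
Proof.
move=> sY sZ iY iZ YZ.
have sYZ : sigma_measurable X (Y \- Z) by exact: measurable_funB.
pose B : set Omega := (Y \- Z) @^-1` `]0, +oo[%classic.
have sB : g_sigma_algebra_preimage X B by exact: sigma_measurable_sub.
have mB := sigma_measurable_set sB.
have iYB : Pr.-integrable B (EFin \o Y) by exact: integrableS iY.
have iZB : Pr.-integrable B (EFin \o Z) by exact: integrableS iZ.
have mYZ : measurable_fun B (EFin \o (Y \- Z)).
  by apply/measurable_EFinP; apply: measurable_funTS; exact: sigma_measurable_fun.
have : (\int[Pr]_(w in B) `|(Y w - Z w)%:E| = 0)%E.
  apply/eqP; rewrite eq_le integral_ge0 ?andbT; last by move=> w _; exact: abse_ge0.
  rewrite (eq_integral (fun w => (Y w)%:E - (Z w)%:E)%E); last first.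
    move=> w; rewrite inE /B/= in_itv/= andbT => YZ0.
    by rewrite ger0_norm// ltW.
  rewrite integralB//.
  by rewrite lee_subel_addr ?add0e ?YZ//; exact: integrable_fin_num.
move/(ae_eq_integral_abs Pr mB mYZ); apply: filterS => w YZ0.
rewrite leNgt; apply/negP => ZY.
have := YZ0; rewrite /B/= in_itv/= andbT subr_gt0 => /(_ ZY) [].
lra.
Qed.

Lemma cond_prob_itv A (Q : Omega -> R) : measurable A -> is_cond_prob Pr X A Q ->
  {ae Pr, forall w, 0 <= Q w <= 1}.
Proof.
move=> mA [sQ iQ QA].
have icst c : Pr.-integrable setT (EFin \o (cst c : Omega -> R)).
  by apply: bounded_measurable_integrable => //; exact: bounded_measurable_cst.
have scst c : sigma_measurable X (cst c : Omega -> R) by exact: measurable_cst.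
have Q0 : {ae Pr, forall w, 0 <= Q w}.
  apply: (le_ae_of_le_integral (scst 0) sQ (icst 0) iQ) => B sB.
  by rewrite integral0 QA.
have Q1 : {ae Pr, forall w, Q w <= 1}.
  apply: (le_ae_of_le_integral sQ (scst 1) iQ (icst 1)) => B sB.
  have mB := sigma_measurable_set sB.
  rewrite QA//= integral_cst// mul1e le_measure ?inE//; exact: measurableI.
by apply: filterS2 Q0 Q1 => w -> ->.
Qed.

Lemma bounded_is_cond_prob A (Q : Omega -> R) : measurable A -> sigma_measurable X Q ->
  bounded_measurable Q ->
  (forall C, measurable C -> fine (Pr (A `&` X @^-1` C)) = E (fun w => Q w * \1_C (X w))) ->
  is_cond_prob Pr X A Q.
Proof.
move=> mA sQ bQ QA; split=> //; first exact: bounded_measurable_integrable.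
move=> B sB; have mB := sigma_measurable_set sB.
have [C mC BC] := sigma_preimage_ex sB.
rewrite -[RHS]prob_fineK; last exact: measurableI.
rewrite BC QA// -BC -[LHS]fineK; last first.
  exact/integrable_fin_num/bounded_measurable_integrable.
rewrite -/(Rintegral _ _ _) mean_restrict; congr EFin; apply: eq_Rintegral => w _.
by rewrite BC !indicE; congr (_ * (nat_of_bool _)%:R); apply/idP/idP; rewrite !inE.
Qed.

End conditioning.

Lemma measurable_bool_set {d'} {S : measurableType d'} (b : S -> bool) :
  measurable_fun setT b -> measurable [set x | b x].
Proof.
move=> mb; rewrite (_ : [set x | b x] = setT `&` b @^-1` [set true]) ?setTI//.
by rewrite -[X in measurable X]setTI; exact: mb.
Qed.

(** * Comparison with an independent variable *)

Section independent_comparison.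
Context {d : measure_display} {Omega : measurableType d} {R : realType}.
Variable Pr : probability Omega R.
Context {d' : measure_display} {S : measurableType d'} (Y : Omega -> S).
Hypothesis mY : measurable_fun setT Y.
Local Notation E := (Rintegral Pr setT).
Local Notation F := (cdfr Pr).
Local Notation G := (cdfl Pr).

Lemma independent_prob (V : Omega -> R) (D : set (R * S)) : measurable_fun setT V ->
  independent Pr V Y -> measurable D ->
  fine (Pr [set w | D (V w, Y w)]) = E (fun w => fine (Pr [set w' | D (V w', Y w)])).
Proof.
move=> mV VY mD.
have mDY (f : Omega -> R * S) : measurable_fun setT f -> measurable [set w | D (f w)].
  by move=> mf; rewrite -[X in measurable X]setTI; exact: mf.
have indicD (f : Omega -> R * S) w : \1_[set w | D (f w)] w = \1_D (f w) :> R.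
  by rewrite !indicE; congr (nat_of_bool _)%:R; apply/idP/idP; rewrite !inE.
rewrite -mean_indic; last by apply: mDY; exact: measurable_fun_pair.
have -> : E \1_[set w | D (V w, Y w)] = E (fun w => \1_D (V w, Y w)).
  by apply: eq_Rintegral => w _; exact: (indicD (fun w => (V w, Y w)) w).
have mI : measurable_fun setT (\1_D : R * S -> R) by exact: measurable_indic.
rewrite (independent_fubini (M := 1) mV mY VY mI); last first.
  by move=> z; rewrite indicE; case: (_ \in _); rewrite ?lexx ler01.
apply: eq_Rintegral => w _; rewrite -mean_indic; last first.
  by apply: mDY; exact: measurable_fun_pair.
by apply: eq_Rintegral => w' _; rewrite -(indicD (fun w' => (V w', Y w)) w').
Qed.

Variables (V : Omega -> R) (y : S -> R) (C : set S).
Hypotheses (mV : measurable_fun setT V) (VY : independent Pr V Y).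
Hypotheses (my : measurable_fun setT y) (mC : measurable C).

Let my2 : measurable_fun setT (fun z : R * S => y z.2).
Proof. exact: (measurableT_comp my measurable_snd). Qed.

Let mC2 : measurable [set z : R * S | C z.2].
Proof. by rewrite -[X in measurable X]setTI; exact: measurable_snd. Qed.

Lemma independent_prob_le :
  fine (Pr ([set w | V w <= y (Y w)] `&` Y @^-1` C)) =
  E (fun w => F V (y (Y w)) * \1_C (Y w)).
Proof.
rewrite (@independent_prob V ([set z | z.1 <= y z.2] `&` [set z | C z.2]))//; last first.
  apply: measurableI => //.
  exact: measurable_bool_set (measurable_fun_ler (@measurable_fst _ _ R S) my2).
apply: eq_Rintegral => w _; rewrite indicE; case: (boolP (Y w \in C)) => [|] Cw.
  rewrite mulr1; congr (fine (Pr _)); rewrite predeqE => w' /=; split=> [[]//|].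
  by rewrite inE in Cw.
rewrite mulr0 (_ : [set w' | _] = set0) ?measure0// predeqE => w' /=; split=> // -[_ CY].
by move: Cw; rewrite notin_setE; apply.
Qed.

Lemma independent_prob_lt :
  fine (Pr ([set w | V w < y (Y w)] `&` Y @^-1` C)) =
  E (fun w => G V (y (Y w)) * \1_C (Y w)).
Proof.
rewrite (@independent_prob V ([set z | z.1 < y z.2] `&` [set z | C z.2]))//; last first.
  apply: measurableI => //.
  exact: measurable_bool_set (measurable_fun_ltr (@measurable_fst _ _ R S) my2).
apply: eq_Rintegral => w _; rewrite indicE; case: (boolP (Y w \in C)) => [|] Cw.
  rewrite mulr1; congr (fine (Pr _)); rewrite predeqE => w' /=; split=> [[]//|].
  by rewrite inE in Cw.
rewrite mulr0 (_ : [set w' | _] = set0) ?measure0// predeqE => w' /=; split=> // -[_ CY].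
by move: Cw; rewrite notin_setE; apply.
Qed.

End independent_comparison.

(** * Characterizations of p-variables and p*-variables *)

Section p_variables.
Context {d : measure_display} {Omega : measurableType d} {R : realType}.
Variable Pr : probability Omega R.
Hypothesis Pr_rich : rich Pr.
Context {n : nat} (X : {RV Pr >-> n.-tuple R}) (P : {RV Pr >-> R}).
Hypothesis P_meas : sigma_measurable X P.
Local Notation E := (Rintegral Pr setT).
Local Notation F := (cdfr Pr).
Local Notation G := (cdfl Pr).

Let mX : measurable_fun setT X. Proof. by []. Qed.
Let mP : measurable_fun setT P. Proof. by []. Qed.

Lemma identically_distributed_cdfr (T T' : {RV Pr >-> R}) :
  identically_distributed T' T -> F T' = F T.
Proof.
move=> TT'; apply/funext => x; congr fine.
exact: (TT' _ (measurable_itv `]-oo, x])).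
Qed.

Lemma identically_distributed_cdfl (T T' : {RV Pr >-> R}) :
  identically_distributed T' T -> G T' = G T.
Proof.
move=> TT'; apply/funext => x; congr fine.
exact: (TT' _ (measurable_itv `]-oo, x[)).
Qed.

Lemma bounded_cdfr (T T' : Omega -> R) : measurable_fun setT T -> measurable_fun setT T' ->
  bounded_measurable (F T' \o T).
Proof.
move=> mT mT'; apply: (@itv_bounded_measurable _ _ _ _ 0 1) => [|w]; last exact: cdfr_itv.
by apply: measurableT_comp => //; exact: measurable_cdfr.
Qed.

Lemma bounded_cdfl (T T' : Omega -> R) : measurable_fun setT T -> measurable_fun setT T' ->
  bounded_measurable (G T' \o T).
Proof.
move=> mT mT'; apply: (@itv_bounded_measurable _ _ _ _ 0 1) => [|w]; last exact: cdfl_itv.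
by apply: measurableT_comp => //; exact: measurable_cdfl.
Qed.

Lemma randomizer_cdfl V c : randomizer Pr V -> 0 <= c <= 1 -> G V c = c.
Proof.
move=> [mV V01 FV] /andP[c0 c1]; apply/eqP; rewrite eq_le.
rewrite -[X in _ <= X]FV ?c0// cdfl_le_cdfr//=.
apply/ler_addgt0Pr => e e0; have [ce|ec] := ltP c e.
  by have /andP[] := cdfl_itv Pr mV c; lra.
have : F V (c - e) <= G V c by apply: cdfr_le_cdfl => //; lra.
by rewrite FV; lra.
Qed.

(** With the identity into [Omega], equipped with the sigma-algebra of [X], as conditioning
    variable, any [T] measurable for that sigma-algebra is a function of it, without being factored
    through [X]. *)
Lemma independent_sigma (T : Omega -> R) : independent Pr T X ->
  independent Pr T (id : Omega -> g_sigma_algebra_preimageType X).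
Proof.
by move=> TX A B mA /sigma_preimage_ex[C mC ->]; exact: TX.
Qed.

Lemma cond_prob_copy (T T' : {RV Pr >-> R}) C :
  sigma_measurable X T -> independent Pr T' X -> measurable C ->
  fine (Pr ([set w | T' w <= T w] `&` X @^-1` C)) = E (fun w => F T' (T w) * \1_C (X w)).
Proof.
move=> sT T'X mC.
have mid : measurable_fun setT (id : Omega -> g_sigma_algebra_preimageType X).
  by move=> _ B mB; rewrite setTI; exact: sigma_measurable_set mX _ mB.
have mT' : measurable_fun setT T' by [].
rewrite (independent_prob_le mid mT' (independent_sigma T'X) sT (sigma_preimage X mC)).
by apply: eq_Rintegral => w _; rewrite !indicE; congr (_ * (nat_of_bool _)%:R);
  apply/idP/idP; rewrite !inE.
Qed.

Lemma expectation_exists_bounded (Z : Omega -> R) : bounded_measurable Z ->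
  expectation_exists Pr Z.
Proof.
move=> bZ; left; have bZp : bounded_measurable (Z^\+)%R.
  have [mZ [M ZM]] := bZ; split; first exact: measurable_funrpos.
  exists M => w; rewrite (le_trans _ (ZM w))//= ger0_norm ?le_max ?lexx ?orbT//.
  by rewrite ge_max ler_norm normr_ge0.
by rewrite (expectation_mean Pr bZp) ltry.
Qed.

(** The indicator of []a, +oo[] is an increasing test function; complements turn the comparison of
    its means into the bound. *)
Lemma p_variable_cdfr_le a : p_variable P -> 0 <= a <= 1 -> F P a <= a.
Proof.
move=> [U [uU UP]] a01.
pose f (x : R) : R := (a < x)%R%:R.
have hf : {homo f : x y / x <= y}.
  move=> x y xy; rewrite /f ler_nat; have [ax|//] := ltP a x.
  by rewrite (lt_le_trans ax xy).
have fE (Z : {RV Pr >-> R}) : f \o Z = \1_(~` [set w | Z w <= a]).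
  apply/funext => w; rewrite indicE /f /=; congr (nat_of_bool _)%:R.
  by apply/idP/idP; rewrite inE /= ltNge => /negP.
have mZ (Z : {RV Pr >-> R}) : measurable [set w | Z w <= a] by exact: measurable_le_cst.
have bf (Z : {RV Pr >-> R}) : bounded_measurable (f \o Z).
  by rewrite fE; apply: bounded_measurable_indic; exact: measurableC.
have := UP f hf (expectation_exists_bounded (bf U)) (expectation_exists_bounded (bf P)).
rewrite !(expectation_mean _ (bf _)) lee_fin !fE !mean_indic; [|exact: measurableC..].
rewrite !prob_setC// -/(F U a) -/(F P a) uniform01_cdfr//; lra.
Qed.

Lemma p_variable_cond : p_variable P -> exists T T' : {RV Pr >-> R},
  [/\ sigma_measurable X T, identically_distributed T' T, independent Pr T' X &
    exists Q : Omega -> R, is_cond_prob Pr X [set w | T' w <= T w] Q /\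
      {ae Pr, forall w, Q w <= P w}].
Proof.
move=> pP; have [V [rV VX]] := rich_randomizer Pr_rich mX.
have [T' [FT' T'X]] := quantile_copy mP rV VX.
exists P, T'; split=> //; first exact: cdfr_identically_distributed.
have mT' : measurable_fun setT T' by [].
have mA : measurable [set w | T' w <= P w].
  by apply: measurable_bool_set; exact: measurable_fun_ler.
exists (F P \o P); split.
  apply: bounded_is_cond_prob => //.
  - by apply: sigma_measurable_comp => //; exact: measurable_cdfr.
  - exact: bounded_cdfr.
  - move=> C mC; rewrite cond_prob_copy//.
    by apply: eq_Rintegral => w _; rewrite FT'.
(* This exceptional set is null because [F P 0 <= 0]; where [P >= 1] the bound is trivial. *)
exists [set w | P w <= 0]; split.
- exact: measurable_le_cst.
- rewrite -prob_fineK; last exact: measurable_le_cst.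
  congr EFin; apply/eqP; rewrite eq_le prob_ge0 andbT.
  by apply: p_variable_cdfr_le => //; rewrite lexx ler01.
- move=> w /= h; rewrite leNgt; apply/negP => P0; apply: h => /=.
  have [P1|P1] := leP 1 (P w); last by apply: p_variable_cdfr_le => //; lra.
  by rewrite (le_trans _ P1)//; have /andP[] := cdfr_itv Pr mP (P w).
Qed.

Lemma cond_p_variable (T T' : {RV Pr >-> R}) Q : sigma_measurable X T ->
  identically_distributed T' T -> independent Pr T' X ->
  is_cond_prob Pr X [set w | T' w <= T w] Q -> {ae Pr, forall w, Q w <= P w} ->
  p_variable P.
Proof.
move=> sT TT' T'X [sQ iQ QA] QP.
have mT : measurable_fun setT T by [].
have mT' : measurable_fun setT T' by [].
have mA : measurable [set w | T' w <= T w].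
  by apply: measurable_bool_set; exact: measurable_fun_ler.
have bFT := bounded_cdfr mT mT.
have [V [rV VTX]] := rich_randomizer_pair Pr_rich mX mT.
have VT : independent Pr V T.
  exact: (independent_comp (@measurable_id _ _ setT) measurable_fst VTX).
have mW := measurable_distributional_transform mT rV.
exists (as_mfun mW); split; first exact: distributional_transform_uniform.
have FQ : {ae Pr, forall w, F T (T w) <= Q w}.
  have sFT : sigma_measurable X (F T \o T).
    by apply: sigma_measurable_comp => //; exact: measurable_cdfr.
  apply: (le_ae_of_le_integral mX sFT sQ) => //; first exact: bounded_measurable_integrable.
  move=> B sB; rewrite QA//.
  have [_ _ ->] // : is_cond_prob Pr X [set w | T' w <= T w] (F T \o T).
  apply: bounded_is_cond_prob => // C mC.
  by rewrite cond_prob_copy// (identically_distributed_cdfr TT').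
have WP : {ae Pr, forall w, distributional_transform Pr T V w <= P w}.
  apply: filterS2 FQ QP => w FQ QP; apply: le_trans QP; apply: le_trans FQ.
  by have /andP[] := distributional_transform_itv mT rV w.
move=> f hf _ _; apply: le_expectation_ae.
- by apply: measurableT_comp => //; exact: nondecreasing_measurable.
- by apply: measurableT_comp => //; exact: nondecreasing_measurable.
- by apply: filterS WP => w /hf.
Qed.

(** Integrating out [V] at fixed [(T, X)], its mean 1/2 puts the transform halfway between [G T] and
    [F T]. In [g], [unit_clip] keeps the weight in ]0, 1[ on the whole domain and fixes the values
    of [V]. *)
Lemma mean_distributional_transform (T V : Omega -> R) C :
  measurable_fun setT T -> randomizer Pr V ->
  independent Pr V (fun w => (T w, X w)) -> measurable C ->
  E (fun w => distributional_transform Pr T V w * \1_C (X w)) =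
  2^-1 * E (fun w => F T (T w) * \1_C (X w)) + 2^-1 * E (fun w => G T (T w) * \1_C (X w)).
Proof.
move=> mT rV VTX mC; have [mV V01 _] := rV.
pose g (z : R * (R * n.-tuple R)) :=
  (G T z.2.1 + unit_clip z.1 * (F T z.2.1 - G T z.2.1)) * \1_C z.2.2.
have m21 : measurable_fun setT (fun z : R * (R * n.-tuple R) => z.2.1).
  exact: (measurableT_comp measurable_fst measurable_snd).
have mGz : measurable_fun setT (fun z : R * (R * n.-tuple R) => G T z.2.1).
  exact: (measurableT_comp (measurable_cdfl Pr mT) m21).
have mFz : measurable_fun setT (fun z : R * (R * n.-tuple R) => F T z.2.1).
  exact: (measurableT_comp (measurable_cdfr Pr mT) m21).
have mg : measurable_fun setT g.
  apply: measurable_funM.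
    apply: measurable_funD => //; apply: measurable_funM.
      exact: (measurableT_comp measurable_unit_clip measurable_fst).
    exact: measurable_funB.
  apply: measurableT_comp; first exact: measurable_indic.
  exact: (measurableT_comp measurable_snd measurable_snd).
have g01 z : 0 <= g z <= 1.
  rewrite /g; have := unit_clip_itv z.1; have := cdfl_le_cdfr Pr mT z.2.1.
  have := cdfr_itv Pr mT z.2.1; have := cdfl_itv Pr mT z.2.1.
  move: (G _ _) (F _ _) (unit_clip _) => p q u /andP[? ?] /andP[? ?] ? /andP[? ?].
  by rewrite indicE; case: (_ \in _); rewrite ?mulr1 ?mulr0 ?lexx ?ler01//; apply/andP; split; nra.
transitivity (E (fun w => g (V w, (T w, X w)))).
  by apply: eq_Rintegral => w _; rewrite /g /= /unit_clip V01.
rewrite (independent_fubini (M := 1) _ _ VTX mg)//; last exact: measurable_fun_pair.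
have bC : bounded_measurable (fun w => \1_C (X w) : R).
  apply: (@itv_bounded_measurable _ _ _ _ 0 1) => [|w].
    by apply: measurableT_comp => //; exact: measurable_indic.
  by rewrite indicE; case: (_ \in _); rewrite ?lexx ler01.
have bF := bounded_measurableM (bounded_cdfr mT mT) bC.
have bG := bounded_measurableM (bounded_cdfl mT mT) bC.
rewrite -!meanZ// -meanD; [|exact: bounded_measurableZ..].
have bV : bounded_measurable V.
  by apply: (@itv_bounded_measurable _ _ _ _ 0 1) => // w; have := V01 w; lra.
apply: eq_Rintegral => w _; rewrite /g /=.
rewrite (@eq_Rintegral _ _ _ _ _ (fun w' => G T (T w) * \1_C (X w) +
  ((F T (T w) - G T (T w)) * \1_C (X w)) * V w')); last first.
  by move=> w' _; rewrite /unit_clip V01; ring.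
rewrite meanD; [|exact: bounded_measurable_cst|exact: bounded_measurableZ].
rewrite mean_cst meanZ// mean_randomizer//; first by field.
by move=> w'; have := V01 w'; lra.
Qed.

(* [W] is the distributional transform of [T]: it is uniform, and its conditional mean
   given [X] is the average of the conditional probabilities of [T' <= T] and [T' < T]. *)
Lemma cond_pstar_variable (T T' : {RV Pr >-> R}) (Q : Omega -> R) :
  identically_distributed T' T -> independent Pr T' (fun w => (T w, X w)) ->
  sigma_measurable X Q -> {ae Pr, forall w, 0 <= Q w <= 1} ->
  (forall B, g_sigma_algebra_preimage X B ->
    (2^-1 * fine (Pr ([set w | (T' w <= T w)%R] `&` B)) +
     2^-1 * fine (Pr ([set w | (T' w < T w)%R] `&` B)))%:E <=
    \int[Pr]_(w in B) (Q w)%:E)%E ->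
  {ae Pr, forall w, Q w <= P w} -> pstar_variable P.
Proof.
move=> TT' T'TX sQ Q01 QB QP.
have mT : measurable_fun setT T by [].
have mT' : measurable_fun setT T' by [].
have mTX : measurable_fun setT (fun w => (T w, X w)) by exact: measurable_fun_pair.
have [V [rV VTX]] := rich_randomizer_pair Pr_rich mX mT.
have VT : independent Pr V T.
  exact: (independent_comp (@measurable_id _ _ setT) measurable_fst VTX).
have mW := measurable_distributional_transform mT rV.
exists (as_mfun mW); split; first exact: distributional_transform_uniform.
set W := distributional_transform Pr T V in mW *.
have W01 w : 0 <= W w <= 1.
  have := distributional_transform_itv mT rV w.
  by have := cdfr_itv Pr mT (T w); have := cdfl_itv Pr mT (T w); rewrite -/W; lra.
(* [Q] obeys its bounds only almost surely; this modification has values in [0, 1] everywhere, as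
   [le_mean_concave] requires. *)
pose Z w : R := Num.max 0 (Num.min 1 (Q w)).
have Z01 w : 0 <= Z w <= 1 by rewrite /Z le_max lexx ge_max ler01 ge_min lexx.
have sZ : sigma_measurable X Z.
  by apply: measurable_maxr => //; exact: measurable_minr.
have mZ := sigma_measurable_fun mX sZ; have mQ := sigma_measurable_fun mX sQ.
have ZQ : {ae Pr, forall w, Z w = Q w}.
  by apply: filterS Q01 => w /andP[Q0 Q1]; rewrite /Z min_r// max_r.
have bZ := itv_bounded_measurable mZ Z01.
have WZ a b : E (fun w => W w * \1_[set w | a <= Z w < b] w) <=
              E (fun w => Z w * \1_[set w | a <= Z w < b] w).
  set B := [set w | a <= Z w < b].
  have sB : g_sigma_algebra_preimage X B.
    have := sigma_measurable_sub sZ (measurable_itv `[a, b[).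
    by congr g_sigma_algebra_preimage; rewrite predeqE => w /=; rewrite in_itv.
  have mB := sigma_measurable_set mX sB.
  have [C mC BC] := sigma_preimage_ex sB.
  have BCE w : \1_B w = \1_C (X w) :> R.
    by rewrite BC !indicE; congr (nat_of_bool _)%:R; apply/idP/idP; rewrite !inE.
  rewrite -[leRHS]mean_restrict -lee_fin [leRHS]fineK; last first.
    exact/integrable_fin_num/bounded_measurable_integrable.
  have -> : (\int[Pr]_(w in B) (Z w)%:E = \int[Pr]_(w in B) (Q w)%:E)%E.
    apply: ae_eq_integral => //.
    - by apply/measurable_EFinP; exact: measurable_funTS.
    - by apply/measurable_EFinP; exact: measurable_funTS.
    - by apply: filterS ZQ => w /= ->.
  apply: le_trans (QB _ sB); rewrite lee_fin.
  rewrite (@eq_Rintegral _ _ _ _ _ (fun w => W w * \1_C (X w))); last by move=> w _; rewrite BCE.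
  rewrite mean_distributional_transform//.
  have mCT : measurable (setT `*` C : set (R * n.-tuple R)) by exact: measurableX.
  have TXB : (fun w => (T w, X w)) @^-1` (setT `*` C) = B.
    by rewrite BC predeqE => w /=; split=> [[]|].
  have CTE w : \1_(setT `*` C) (T w, X w) = \1_C (X w) :> R.
    by rewrite !indicE; congr (nat_of_bool _)%:R; apply/idP/idP; rewrite !inE //= => -[].
  have h1 := independent_prob_le mTX mT' T'TX measurable_fst mCT.
  have h2 := independent_prob_lt mTX mT' T'TX measurable_fst mCT.
  rewrite TXB /= in h1 h2; rewrite h1 h2.
  rewrite (identically_distributed_cdfr TT') (identically_distributed_cdfl TT').
  by apply: lerD; rewrite ler_pM2l ?invr_gt0// le_eqVlt; apply/orP; left; apply/eqP;
    apply: eq_Rintegral => w _; rewrite CTE.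
have ZP : {ae Pr, forall w, Z w <= P w} by apply: filterS2 ZQ QP => w ->.
move=> f hf cf _ _.
have := le_mean_concave hf cf mW W01 mZ Z01 WZ.
rewrite -lee_fin -!expectation_mean; [|exact: bounded_homo..].
move=> /le_trans; apply; apply: le_expectation_ae.
- by apply: measurableT_comp => //; exact: nondecreasing_measurable.
- by apply: measurableT_comp => //; exact: nondecreasing_measurable.
- by apply: filterS ZP => w /hf.
Qed.

End p_variables.

(** * From p*-variables to conditional probabilities *)

Section pstar_variables.
Context {d : measure_display} {Omega : measurableType d} {R : realType}.
Variable Pr : probability Omega R.
Hypothesis Pr_rich : rich Pr.
Context {n : nat} (X : {RV Pr >-> n.-tuple R}) (P : {RV Pr >-> R}).
Hypothesis P_meas : sigma_measurable X P.
Local Notation E := (Rintegral Pr setT).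
Local Notation S := (stop_loss Pr).

Let mX : measurable_fun setT X. Proof. by []. Qed.
Let mP : measurable_fun setT P. Proof. by []. Qed.

Lemma concave_opp_pos_part (c : R) : concave_function (fun x : R => - Num.max 0 (c - x)).
Proof.
move=> t x y _ _; rewrite !opprK.
have : t%:num <= 1 :> R by exact: le1.
have : 0 <= t%:num :> R by exact: ge0.
set s : R := t%:num => s0 s1.
change (Num.max 0 (c - (s * x + (1 - s) * y)) <=
  s * Num.max 0 (c - x) + (1 - s) * Num.max 0 (c - y)).
have hx : c - x <= Num.max 0 (c - x) by rewrite le_max lexx orbT.
have hy : c - y <= Num.max 0 (c - y) by rewrite le_max lexx orbT.
have hx0 : 0 <= Num.max 0 (c - x) by rewrite le_max lexx.
have hy0 : 0 <= Num.max 0 (c - y) by rewrite le_max lexx.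
move: (Num.max 0 (c - x)) (Num.max 0 (c - y)) hx hy hx0 hy0 => p q hx hy hx0 hy0.
by rewrite ge_max; apply/andP; split; nra.
Qed.

(** The test functions are nonpositive, so their expectations exist in [-oo, +oo] even before the
    negative part of [P] is known to be integrable. *)
Lemma pstar_stop_loss : pstar_variable P -> exists U : Omega -> R,
  [/\ measurable_fun setT U, randomizer Pr U & forall c : R,
  ('E_Pr[(fun w => - Num.max 0 (c - U w))%R] <= 'E_Pr[(fun w => - Num.max 0 (c - P w))%R])%E].
Proof.
move=> [U [uU UP]]; have [rU UE] := uniform01_randomizer uU.
have mU : measurable_fun setT U by [].
have [mV _ _] := rU; exists (unit_clip \o U); split=> // c.
pose f (x : R) := - Num.max 0 (c - x).
have hf : {homo f : x y / x <= y}.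
  move=> x y xy; rewrite /f lerN2 ge_max !le_max lexx /=; apply/orP; right; lra.
have mf (Z : Omega -> R) : measurable_fun setT Z -> measurable_fun setT (f \o Z).
  by move=> mZ; apply: measurableT_comp => //; exact: nondecreasing_measurable.
have ex (Z : Omega -> R) : expectation_exists Pr (f \o Z).
  left; rewrite (_ : (_^\+)%R = cst 0) ?expectation_cst ?ltry//.
  by apply/funext => w; rewrite /funrpos /= max_r// oppr_le0 le_max lexx.
have := UP f hf (concave_opp_pos_part c) (ex U) (ex P); apply: le_trans.
apply: le_expectation_ae; [exact: mf|exact: mf|].
by apply: filterS UE => w /= ->.
Qed.

(** At [c = 0] the uniform side of [pstar_stop_loss] vanishes, so the negative part of [P] has mean
    0. *)
Lemma pstar_ae_ge0 : pstar_variable P -> {ae Pr, forall w, 0 <= P w}.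
Proof.
move=> /pstar_stop_loss[U [mU [_ U01 _] UP]].
have := UP 0; rewrite (_ : (fun w => - Num.max 0 (0 - U w)) = cst 0); last first.
  by apply/funext => w; rewrite max_l ?oppr0// sub0r oppr_le0; have := U01 w; lra.
rewrite expectation_cst unlock => E0.
pose g w : \bar R := (Num.max 0 (0 - P w))%:E.
have mg : measurable_fun setT g.
  by apply/measurable_EFinP; apply: measurable_maxr => //; exact: measurable_funB.
have g0 w : (0 <= g w)%E by rewrite lee_fin le_max lexx.
have : (\int[Pr]_w `|g w| = 0)%E.
  apply/eqP; rewrite eq_le integral_ge0 ?andbT//.
  rewrite (eq_integral g); last by move=> w _; rewrite gee0_abs.
  rewrite -leeN2 oppe0 -integral_ge0N//.
move/(ae_eq_integral_abs Pr measurableT mg); apply: filterS => w /(_ I)[] h.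
have : 0 - P w <= Num.max 0 (0 - P w) by rewrite le_max lexx orbT.
lra.
Qed.

(* The truncation [min P a] has mean [1/2] for a suitable [a], which turns the
   increasing concave comparison into a convex one. *)
Lemma pstar_truncation : pstar_variable P -> exists V : Omega -> R,
  [/\ sigma_measurable X V, stop_loss_dominated Pr V, S V 1 = 2^-1 &
    {ae Pr, forall w, V w <= P w}].
Proof.
move=> pP; have P0 := pstar_ae_ge0 pP.
have [U [mU rU UP]] := pstar_stop_loss pP.
have U0 w : 0 <= U w by have [_ /(_ w) + _] := rU; lra.
pose Q w : R := Num.max 0 (P w).
have mQ : measurable_fun setT Q by exact: measurable_maxr.
have Q0 w : 0 <= Q w by rewrite le_max lexx.
have SQ c : 0 <= c <= 1 -> S Q c <= c ^+ 2 / 2.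
  move=> c01; rewrite -(stop_loss_randomizer mU U0 rU c01).
  have bN (Z : Omega -> R) : measurable_fun setT Z -> (forall w, 0 <= Z w) ->
      ('E_Pr[(fun w => - Num.max 0 (c - Z w))%R] = (- S Z c)%:E)%E.
    move=> mZ Z0; rewrite (_ : (fun w => _) = (fun w => (-1) * Num.max 0 (c - Z w))); last first.
      by apply/funext => w; rewrite mulN1r.
    rewrite expectation_mean; last by apply: bounded_measurableZ; exact: bounded_stop_loss.
    by rewrite meanZ ?mulN1r//; exact: bounded_stop_loss.
  rewrite -lerN2 -lee_fin -!bN// (le_trans (UP c))//; apply: le_expectation_ae.
  - by apply: measurableT_comp => //; apply: measurable_maxr => //; exact: measurable_funB.
  - by apply: measurableT_comp => //; apply: measurable_maxr => //; exact: measurable_funB.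
  - apply: aeW => w; rewrite lerN2 ge_max !le_max lexx /=; apply/orP; right.
    by rewrite lerD2l lerN2 le_max lexx orbT.
(* [c - S Q c] is the mean of [min Q c]; it is 0 at 0 and at least 1/2 at 1, so it takes the value
   1/2 at some [a] in [0, 1]. *)
have cS : continuous (fun c => c - S Q c).
  by move=> c; apply: cvgB; [exact: cvg_id|exact: stop_loss_continuous].
have S0 : S Q 0 = 0.
  apply/eqP; rewrite eq_le stop_loss_ge0 andbT.
  by rewrite -[leRHS](mul0r 2^-1) -[X in X * _](expr0n _ 2) SQ// lexx ler01.
have [|a] := @IVT _ (fun c => c - S Q c) 0 1 2^-1 ler01 (continuous_subspaceT cS).
  rewrite S0 subr0 ge_min le_max invr_ge0 ler0n /=; apply/orP; right.
  by have := SQ 1; rewrite expr1n lexx ler01 => /(_ isT); lra.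
rewrite in_itv/= => a01 Sa; have /andP[a0 a1] := a01.
pose V w : R := Num.min (Q w) a.
have mV : measurable_fun setT V by exact: measurable_minr.
have VE w : V w = a - Num.max 0 (a - Q w).
  rewrite /V; have [Qa|aQ] := leP (Q w) a; first by rewrite max_r; lra.
  by rewrite max_l; lra.
have V01 w : 0 <= V w <= 1.
  by rewrite le_min Q0 a0 ge_min a1 orbT.
have V0 w : 0 <= V w by have /andP[] := V01 w.
have EV : E V = 2^-1.
  rewrite -Sa -[X in X - _](mean_cst Pr) -meanB; last 2 first.
  - exact: bounded_measurable_cst.
  - exact: bounded_stop_loss.
  by apply: eq_Rintegral => w _; exact: VE.
have SV c : a <= c -> S V c = c - 2^-1.
  move=> ac; rewrite -EV -[X in _ = X - _](mean_cst Pr) -meanB; last 2 first.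
  - exact: bounded_measurable_cst.
  - exact: itv_bounded_measurable V01.
  by apply: eq_Rintegral => w _; rewrite max_r// subr_ge0 (le_trans _ ac)// ge_min lexx orbT.
exists V; split.
- by apply: measurable_minr => //; exact: measurable_maxr.
(* Up to [a] the transform does not see the truncation; beyond [a], [c - 1/2 <= c ^+ 2 / 2] amounts
   to [(c - 1) ^+ 2 >= 0]. *)
- split=> // c c01; have [ca|ac] := leP c a.
    rewrite (_ : S V c = S Q c) ?SQ//; apply: eq_Rintegral => w _; rewrite /V.
    have [//|aQ] := leP (Q w) a; rewrite !max_l//; lra.
  by rewrite (SV _ (ltW ac)); have := sqr_ge0 (c - 1); nra.
- by rewrite SV//; lra.
- by apply: filterS P0 => w Pw; rewrite /V /Q max_r// ge_min lexx.
Qed.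

(** Both [T] and [T'] are uniform. As the law of [T'] has no atoms, [T' <= T] and [T' < T] have the
    same conditional probability [E[T | X] = V0]; a single [Q] thus also serves the averaged
    form. *)
Lemma pstar_variable_cond : pstar_variable P -> exists T T' : {RV Pr >-> R},
  [/\ identically_distributed T' T, independent Pr T' (fun w => (T w, X w)) &
    exists Q : Omega -> R, [/\ is_cond_prob Pr X [set w | T' w <= T w] Q,
      is_cond_prob Pr X [set w | T' w < T w] Q & {ae Pr, forall w, Q w <= P w}]].
Proof.
move=> pP; have [V0 [sV0 subV0 SV0 V0P]] := pstar_truncation pP.
have [mV0 V001 _] := subV0.
have [T [uT T01 TV0]] := uniform_refinement Pr_rich mX subV0 SV0.
have mT : measurable_fun setT T by [].
have [U [rU UTX]] := rich_randomizer_pair Pr_rich mX mT.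
have [mU U01 FU] := rU.
have uU := randomizer_uniform01 mU rU.
exists T, (as_mfun mU); split=> //.
  by move=> A mA; rewrite (uT _ mA); exact: uU.
have mTX : measurable_fun setT (fun w => (T w, X w)) by exact: measurable_fun_pair.
have bV0 := itv_bounded_measurable mV0 V001.
have TXC (A : set Omega) C : A `&` X @^-1` C =
    A `&` (fun w => (T w, X w)) @^-1` (setT `*` C).
  by rewrite predeqE => w /=; split=> [[? ?]|[? []]].
have CTE C w : \1_(setT `*` C) (T w, X w) = \1_C (X w) :> R.
  by rewrite !indicE; congr (nat_of_bool _)%:R; apply/idP/idP; rewrite !inE //= => -[].
exists V0; split=> //.
- apply: bounded_is_cond_prob => //.
    by apply: measurable_bool_set; exact: measurable_fun_ler.
  move=> C mC; rewrite TXC.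
  rewrite (independent_prob_le mTX mU UTX measurable_fst (measurableX measurableT mC)).
  by rewrite -TV0//; apply: eq_Rintegral => w _; rewrite CTE /= FU ?T01.
- apply: bounded_is_cond_prob => //.
    by apply: measurable_bool_set; exact: measurable_fun_ltr.
  move=> C mC; rewrite TXC.
  rewrite (independent_prob_lt mTX mU UTX measurable_fst (measurableX measurableT mC)).
  by rewrite -TV0//; apply: eq_Rintegral => w _; rewrite CTE /= randomizer_cdfl ?T01.
Qed.

End pstar_variables.


Theorem proposition4p3 (R : realType) (d : measure_display)
  (Omega : measurableType d) (Pr : probability Omega R)
  (Pr_atomless : atomless Pr) (Pr_rich : rich Pr)
  (n : nat) (X : {RV Pr >-> n.-tuple R})
  (P : {RV Pr >-> R}) (P_meas : sigma_measurable X P) :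
  [/\ (p_variable P <->
       exists T T' : {RV Pr >-> R},
         [/\ sigma_measurable X T,
             identically_distributed T' T,
             independent Pr T' X &
             exists Q : Omega -> R,
               is_cond_prob Pr X [set w | T' w <= T w] Q /\
               {ae Pr, forall w, Q w <= P w}]),
      (pstar_variable P <->
       exists T T' : {RV Pr >-> R},
         [/\ identically_distributed T' T,
             independent Pr T' (fun w => (T w, X w)) &
             exists Q : Omega -> R,
               is_cond_prob Pr X [set w | T' w <= T w] Q /\
               {ae Pr, forall w, Q w <= P w}]) &
      (pstar_variable P <->
       exists T T' : {RV Pr >-> R},
         [/\ identically_distributed T' T,
             independent Pr T' (fun w => (T w, X w)) &
             exists Q Q' : Omega -> R,
               [/\ is_cond_prob Pr X [set w | T' w <= T w] Q,
                   is_cond_prob Pr X [set w | T' w < T w] Q' &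
                   {ae Pr, forall w, 2^-1 * Q w + 2^-1 * Q' w <= P w}]])].

Proof.
have mX : measurable_fun setT X by [].
have mle (T T' : {RV Pr >-> R}) : measurable [set w | T' w <= T w].
  by apply: measurable_bool_set; exact: measurable_fun_ler.
have mlt (T T' : {RV Pr >-> R}) : measurable [set w | T' w < T w].
  by apply: measurable_bool_set; exact: measurable_fun_ltr.
have ltle (T T' : {RV Pr >-> R}) B : g_sigma_algebra_preimage X B ->
    fine (Pr ([set w | T' w < T w] `&` B)) <= fine (Pr ([set w | T' w <= T w] `&` B)).
  move=> /(sigma_measurable_set mX) mB.
  by apply: le_prob; [exact: measurableI..|apply: setSI => w /= /ltW].
split.
- split; first exact: p_variable_cond.
  by move=> [T [T' [sT TT' T'X [Q [QA QP]]]]]; exact: (cond_p_variable Pr_rich sT TT' T'X QA QP).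
- split.
    move=> /(pstar_variable_cond Pr_rich P_meas)[T [T' [TT' T'TX [Q [Q1 _ QP]]]]].
    by exists T, T'; split=> //; exists Q.
  move=> [T [T' [TT' T'TX [Q [QA QP]]]]]; have [sQ iQ QB] := QA.
  apply: (cond_pstar_variable Pr_rich TT' T'TX sQ _ _ QP).
    exact: cond_prob_itv (mle T T') QA.
  move=> B sB; rewrite QB// -prob_fineK; last first.
    by apply: measurableI => //; exact: sigma_measurable_set mX _ sB.
  (* The average of the strict and the non-strict probability is at most the non-strict one. *)
  by rewrite lee_fin; have := ltle T T' B sB; lra.
- split.
    move=> /(pstar_variable_cond Pr_rich P_meas)[T [T' [TT' T'TX [Q [Q1 Q2 QP]]]]].
    exists T, T'; split=> //; exists Q, Q; split=> //.
    by apply: filterS QP => w; lra.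
  move=> [T [T' [TT' T'TX [Q [Q' [QA QA' QP]]]]]].
  have [sQ iQ QB] := QA; have [sQ' iQ' QB'] := QA'.
  apply: (cond_pstar_variable Pr_rich TT' T'TX _ _ _ QP).
  - by apply: measurable_funD; apply: measurable_funM.
  - apply: filterS2 (cond_prob_itv mX (mle T T') QA) (cond_prob_itv mX (mlt T T') QA').
    by move=> w /andP[? ?] /andP[? ?]; apply/andP; split; lra.
  - move=> B sB; have mB := sigma_measurable_set mX sB.
    have iB : Pr.-integrable B (EFin \o Q) by exact: integrableS iQ.
    have iB' : Pr.-integrable B (EFin \o Q') by exact: integrableS iQ'.
    under [leRHS]eq_integral do rewrite EFinD !EFinM.
    rewrite integralD//; [|exact: integrableZl..].
    rewrite !integralZl// QB// QB'// EFinD !EFinM !prob_fineK ?lexx//; exact: measurableI.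
Qed.
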